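(* There is an absolute constant $c>0$ such that every outerstring graph with $n\ge 2$ vertices and arboricity $\alpha$ has treewidth at most $c\,\alpha\log n$.
   Context: An outerstring graph is a graph isomorphic to the intersection graph of a finite collection of curves lying in the closure of the interior of a simple closed curve $C$, each having one endpoint on $C$. The arboricity of a graph is the minimum number of forests into which its edge set can be partitioned. *)

(* Defs.v *)
From HB Require Import structures.
From mathcomp Require Import all_boot all_order all_algebra.
From mathcomp Require Import all_classical all_reals all_analysis.
Set Implicit Arguments. Unset Strict Implicit. Unset Printing Implicit Defensive.
Import Order.TTheory GRing.Theory Num.Theory.
Import numFieldNormedType.Exports.
Local Open Scope classical_set_scope.
Local Open Scope ring_scope.

Definition simple_closed_curve (R : realType) (C : R -> R * R) : Prop :=
  {within `[0, 1], continuous C} /\ C 0 = C 1 /\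
  {in `[0, 1[ &, injective C}.

Definition trace (R : realType) (g : R -> R * R) : set (R * R) := g @` `[0, 1].

Definition curve_interior (R : realType) (C : R -> R * R) : set (R * R) :=
  [set p | ~ trace C p /\
     bounded_set (connected_component (~` trace C) p)].

Definition curve (R : realType) (g : R -> R * R) : Prop :=
  {within `[0, 1], continuous g}.

Local Open Scope nat_scope.
Definition simple_graph (V : finType) (e : rel V) : Prop :=
  symmetric e /\ irreflexive e.

Definition outerstring (R : realType) (V : finType) (e : rel V) : Prop :=
  exists (C : R -> R * R) (g : V -> R -> R * R),
    simple_closed_curve C /\
    (forall v, curve (g v)) /\
    (forall v, trace C (g v 0%R)) /\
    (forall v, trace (g v) `<=` closure (curve_interior C)) /\
    (forall u v, u != v -> (e u v <-> trace (g u) `&` trace (g v) !=set0)).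

Definition acyclic (V : finType) (e : rel V) : Prop :=
  forall s : seq V, uniq s -> 2 < size s -> ~~ cycle e s.

Definition forest_partition (V : finType) (e : rel V) (a : nat) : Prop :=
  exists col : V -> V -> nat,
    (forall u v, col u v = col v u) /\
    (forall u v, e u v -> col u v < a) /\
    (forall i, i < a -> acyclic [rel u v | e u v && (col u v == i)]).

Definition is_arboricity (V : finType) (e : rel V) (a : nat) : Prop :=
  forest_partition e a /\ (forall b, forest_partition e b -> a <= b).

Definition is_tree (T : finType) (t : rel T) : Prop :=
  0 < #|T| /\ simple_graph t /\ (forall x y, connect t x y) /\ acyclic t.

Definition tree_decomposition (V : finType) (e : rel V)
  (T : finType) (t : rel T) (B : T -> {set V}) : Prop :=
  is_tree t /\
  (forall v, exists x, v \in B x) /\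
  (forall u v, e u v -> exists x, (u \in B x) && (v \in B x)) /\
  (forall v x y, v \in B x -> v \in B y ->
     connect [rel p q | [&& t p q, v \in B p & v \in B q]] x y).

Definition treewidth_le (R : realType) (V : finType) (e : rel V) (w : R) : Prop :=
  exists (T : finType) (t : rel T) (B : T -> {set V}),
    tree_decomposition e t B /\ (forall x, ((#|B x|%:R - 1 : R) <= w)%R).

(* Main.v *)
(** An outerstring graph whose vertices are layered so that each has few
    neighbours in its own or higher layers has separators that are short walks
    through the disc: from any point, follow a string towards its root until it
    meets a string of a lower layer, switch to that one, and so on.  Such a
    "leg" meets at most [b] strings per layer, and bounded arboricity gives
    [O(log n)] layers with [b = 4 a] by repeatedly discarding the vertices of
    small degree.

    If there were no balanced separator of size [O(b log n)], then for any two
    nearby points of the closed region bounded by [C] the heavy component left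
    after removing the strings met by their legs lies, by the crossing lemma,
    on one side of these two legs.  Turning around an interior point [p] on the
    other side, from the end of one leg to that of the other, defines an
    additive "angle" on the closed region which agrees with the usual angle on
    [C].  Extending it by the usual angle outside [C] and summing over a fine
    grid contradicts the fact that the angle grows by [2 pi] along a large
    square.  The same summation shows that [C] is the boundary of its exterior,
    which is what the crossing lemma needs.  Balanced separators finally yield
    an elimination ordering, hence a tree decomposition. *)
Require Import Defs.
From HB Require Import structures.
From mathcomp Require Import all_boot all_order all_algebra.
From mathcomp Require Import zify.
Set Implicit Arguments. Unset Strict Implicit. Unset Printing Implicit Defensive.
Import Order.TTheory GRing.Theory Num.Theory.
Local Open Scope nat_scope.

(** * Tree decompositions from balanced separators *)

(** The angle is well defined because heavy components are consistent: removing more strings can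
    only shrink the heavy component, so the side on which it lies may be computed from any larger
    set of at most [9 * (l * b)] strings. The side is recorded by a single parameter, the root on
    $C$ of one string of the component, at which $C$ is cut. Additivity at three nearby points
    removes the strings of all three pairs at once; a pair needs two legs and a short link between
    its points, each of these pieces meets at most [l * b] strings, and three times three gives the
    factor 9. Links and short arcs of $C$ are cheap because the strings meeting a sufficiently small
    set pairwise intersect, and a clique has at most $2a+1$ vertices. Agreement with the usual angle
    on $C$ is arranged by letting the leg of a point of $C$ be constant. The obstacle in the
    crossing lemma is that strings, and hence legs, may touch $C$ or run along it; it must therefore
    hold for paths in the closed region, and directions are viewed from points of $C$ by
    approximating these with exterior points. *)

Lemma parent_tree (T : finType) (r : T -> nat) (par : T -> T) (m : T) :
  par m = m -> (forall x, x != m -> r x < r (par x)) ->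
  is_tree [rel x y | (x != y) && ((par x == y) || (par y == x))].
Proof.
move=> parm par_lt; set t := [rel x y | _].
have tsym : symmetric t by move=> x y /=; rewrite eq_sym orbC.
have conn_m : forall n x, \max_y r y - r x < n -> connect t x m.
  elim=> // n IH x; rewrite ltnS => le_n.
  have [->//|xm] := eqVneq x m.
  have lt_r := par_lt _ xm.
  have le_max : r (par x) <= \max_y r y by apply: leq_bigmax.
  apply: (@connect_trans _ _ (par x)).
    apply: connect1; rewrite /= eqxx andbT.
    by apply: contraTneq lt_r => <-; rewrite ltnn.
  by apply: IH; lia.
split; first by apply/card_gt0P; exists m.
split; first by split=> // x; rewrite /= eqxx.
split=> [x y|s us s_gt2].
  apply: (@connect_trans _ _ m); first exact: (conn_m _ _ (ltnSn _)).
  rewrite (sym_connect_sym tsym); exact: (conn_m _ _ (ltnSn _)).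
apply/negP => cyc.
(* A vertex of least rank on a cycle has its parent as both of its neighbours there. *)
have [x xs xmin] : exists2 x, x \in s & forall y, y \in s -> r x <= r y.
  case: s s_gt2 {us cyc} => // x0 s _.
  have x0s : x0 \in x0 :: s by rewrite mem_head.
  case: (@arg_minnP _ x0 (mem (x0 :: s)) r x0s) => x xs xmin.
  by exists x.
have nbr : forall y, y \in s -> t x y -> y = par x.
  move=> y ys /= /andP[xy /orP[/eqP//|/eqP pyx]].
  have ym : y != m by apply: contraNneq xy => ym; rewrite -pyx ym parm.
  by have := par_lt _ ym; rewrite pyx ltnNge xmin.
have [i s' def_s'] := rot_to xs.
have cyc' : cycle t (x :: s') by rewrite -def_s' rot_cycle.
have us' : uniq (x :: s') by rewrite -def_s' rot_uniq.
have sz' : 2 < size (x :: s') by rewrite -def_s' size_rot.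
have mem_s z : z \in x :: s' -> z \in s by rewrite -def_s' mem_rot.
case: s' {def_s'} cyc' us' sz' mem_s => [|y [|z w]] // cyc' us' _ mem_s.
have txy : t x y by move: cyc' => /= /andP[].
have tlx : t (last z w) x.
  by move: cyc'; rewrite /cycle rcons_path => /andP[_].
have {}tlx : t x (last z w) := etrans (tsym _ _) tlx.
have Ey : y = par x by apply: nbr txy; apply: mem_s; rewrite !in_cons eqxx orbT.
have lzw : last z w \in z :: w by apply: mem_last.
have El : last z w = par x.
  by apply: nbr tlx; apply: mem_s; rewrite 2!in_cons lzw !orbT.
by move: us'; rewrite Ey -El /= lzw andbF.
Qed.

Lemma cat_split (T : Type) (a b s1 s2 : seq T) (v : T) :
  a ++ b = s1 ++ v :: s2 -> (exists s2', a = s1 ++ v :: s2') \/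
    (exists s1', s1 = a ++ s1' /\ b = s1' ++ v :: s2).
Proof.
elim: a s1 => [|x a IH] [|y s1] /=.
- by move=> ->; right; exists [::].
- by move=> ->; right; exists (y :: s1).
- by case=> -> _; left; exists a.
case=> -> /IH[[s2' ->]|[s1' [-> ->]]]; first by left; exists s2'.
by right; exists s1'.
Qed.

Section Comp.
Variables (V : finType) (e : rel V).
Hypothesis e_sym : symmetric e.
Implicit Types (P D S A : {set V}) (u v x y : V).

Definition restr P := [rel x y | [&& e x y, x \in P & y \in P]].
(** The component of [v] in the subgraph induced on [P]; it degenerates to the singleton of [v] when
    [v] lies outside [P]. *)
Definition reach P v : {set V} := [set u | connect (restr P) v u].
Definition nb D : {set V} := [set u | (u \notin D) && [exists x in D, e x u]].

Lemma restr_sym P : symmetric (restr P).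
Proof. by move=> x y /=; rewrite e_sym; congr andb; rewrite andbC. Qed.

Lemma reach_refl P v : v \in reach P v. Proof. by rewrite inE connect0. Qed.

Lemma reach_sub P v : v \in P -> reach P v \subset P.
Proof.
move=> vP; apply/subsetP => u; rewrite inE => /connectP[p pth ->].
elim: p v vP pth => //= y p IH v vP /andP[/and3P[_ _ yP]]; exact: IH.
Qed.

Lemma reach_step P v x y : v \in P -> x \in reach P v -> e x y -> y \in P ->
  y \in reach P v.
Proof.
move=> vP xc exy yP; have xP := subsetP (reach_sub vP) _ xc.
move: xc; rewrite !inE => /connect_trans; apply.
by apply: connect1; rewrite /= exy xP yP.
Qed.

Lemma reach_mono P P' v : P \subset P' -> reach P v \subset reach P' v.
Proof.
move=> /subsetP PP'; apply/subsetP => u; rewrite !inE.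
apply: connect_sub => x y /= /and3P[exy xP yP].
by apply: connect1; rewrite /= exy !PP'.
Qed.

Lemma reach_eq P u v : u \in reach P v -> reach P u = reach P v.
Proof.
rewrite inE => vu; apply/setP => w; rewrite !inE.
by rewrite -(same_connect (sym_connect_sym (@restr_sym P)) vu).
Qed.

Lemma reach_in_closed P v D : v \in D ->
  (forall x y, x \in D -> y \in P -> e x y -> y \in D) -> reach P v \subset D.
Proof.
move=> vD cl; apply/subsetP => u; rewrite inE => /connectP[p pth ->].
elim: p v vD pth => //= y p IH v vD /andP[/and3P[evy _ yP]].
by apply: IH; apply: cl evy.
Qed.

Lemma reach_local P D v : v \in D -> D \subset P ->
  (forall x y, x \in D -> y \in P -> e x y -> y \in D) -> reach P v = reach D v.
Proof.
move=> vD DP cl; apply/eqP; rewrite eqEsubset (reach_mono v DP) andbT.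
have sD := reach_in_closed vD cl.
apply/subsetP => u; rewrite !inE => /connectP[p pth ->].
elim: p {u} v vD pth {sD} => //= y p IH v vD /andP[/and3P[evy _ yP] pth].
have yD := cl _ _ vD yP evy.
by apply: connect_trans (IH _ yD pth); apply: connect1; rewrite /= evy vD.
Qed.

Lemma nb_reach P v u : v \in P -> u \in nb (reach P v) -> u \notin P.
Proof.
move=> vP; rewrite inE => /andP[uc /existsP[x /andP[xc exu]]].
by apply: contra uc; apply: reach_step exu.
Qed.

(** The bag of [v] consists of [v] and its later neighbours in the fill-in graph of the elimination
    order [s]; these are the outside neighbours of the component of [v] in the prefix ending with
    [v]. The parent of [v] is the earliest of them, and the others belong to the bag of the parent.
    So, going up from a bag that contains a given vertex, one stays in such bags until the bag of
    that vertex itself. *)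
Lemma tree_decomp_of_order (s : seq V) w : 0 < #|V| ->
  uniq s -> (forall v, v \in s) -> irreflexive e ->
  (forall s1 v s2, s = s1 ++ v :: s2 ->
     #|nb (reach [set x in rcons s1 v] v)| <= w) ->
  exists (t : rel V) (B : V -> {set V}),
    tree_decomposition e t B /\ forall x, #|B x| <= w.+1.
Proof.
move=> V0 us sV eirr hw.
pose r v := index v s.
have rinj : injective r by move=> x y; apply: index_inj.
pose pre v : {set V} := [set u | r u <= r v].
have preE v : exists s1 s2, s = s1 ++ v :: s2 /\ pre v = [set x in rcons s1 v].
  exists (take (r v) s), (drop (r v).+1 s); split.
    by rewrite -{1}(cat_take_drop (r v) s) (drop_nth v) ?index_mem // nth_index.
  have -> : rcons (take (r v) s) v = take (r v).+1 s.
    by rewrite (take_nth v) ?index_mem // nth_index.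
  by apply/setP => u; rewrite !inE in_take // ltnS.
pose Q v := nb (reach (pre v) v).
have vpre v : v \in pre v by rewrite inE.
have Qgt v u : u \in Q v -> r v < r u.
  by move=> /(nb_reach (vpre v)); rewrite inE -ltnNge.
have Qw v : #|Q v| <= w.
  by have [s1 [s2 [Es Ep]]] := preE v; rewrite /Q Ep; apply: hw Es.
have [v0 _] : exists v0 : V, v0 \in V by apply/card_gt0P.
pose m := [arg max_(x > v0) r x].
have mmax x : r x <= r m.
  by rewrite /m; case: arg_maxnP => // i _; apply.
(* A vertex without later neighbours is hung from the last vertex [m], which keeps the tree
   connected. *)
pose par v := if v == m then m else
  if [pick u in Q v] is Some u0 then [arg min_(u < u0 in Q v) r u] else m.
have parP v : v != m -> r v < r (par v) /\
   (forall u, u \in Q v -> par v \in Q v /\ r (par v) <= r u).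
  move=> vm; rewrite /par (negbTE vm); case: pickP => [u0 u0Q|Q0].
    case: arg_minnP => // u uQ umin; split; first exact: Qgt.
    by move=> u' u'Q; split=> //; apply: umin.
  split=> [|u uQ]; last by have := Q0 u; rewrite uQ.
  by rewrite ltn_neqAle mmax andbT; apply: contra vm => /eqP/rinj->.
exists [rel x y | (x != y) && ((par x == y) || (par y == x))].
exists (fun v => v |: Q v); split; last first.
  by move=> x; rewrite cardsU1; have := Qw x; case: (_ \in _) => /=; lia.
split; first by apply: (@parent_tree _ r par m) => [|x /parP[]//]; rewrite /par eqxx.
split; first by move=> v; exists v; rewrite setU11.
have edge u v : e u v -> r u < r v -> v \in Q u.
  move=> euv ruv; rewrite inE; apply/andP; split.
    apply: contraL ruv => /(subsetP (reach_sub (vpre u))).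
    by rewrite inE -leqNgt.
  by apply/existsP; exists u; rewrite reach_refl.
split.
  move=> u v euv; have [ruv|rvu|/rinj uv] := ltngtP (r u) (r v).
  - by exists u; rewrite setU11 inE edge ?orbT.
  - by exists v; rewrite setU11 andbT inE edge ?orbT // e_sym.
  - by rewrite uv eirr in euv.
move=> v; set R := [rel p q | _].
have Rsym : symmetric R.
  move=> p q; rewrite /= [q == p]eq_sym [(par q == p) || _]orbC.
  by congr andb; rewrite andbC.
have main : forall n x, r v - r x < n -> v \in x |: Q x -> connect R x v.
  elim=> // n IH x; rewrite ltnS => le_n vB.
  have [->//|xv] := eqVneq x v.
  have vQ : v \in Q x by move: vB; rewrite inE inE eq_sym (negbTE xv).
  have rxv := Qgt _ _ vQ.
  have xm : x != m by apply: contraTneq rxv => ->; rewrite -leqNgt.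
  have [rp /(_ _ vQ)[pQ pv]] := parP _ xm.
  have vBp : v \in par x |: Q (par x).
    have [->|pv'] := eqVneq (par x) v; first exact: setU11.
    rewrite inE; apply/orP; right.
    have rpv : r (par x) < r v.
      by rewrite ltn_neqAle pv andbT; apply: contra pv' => /eqP/rinj->.
    (* [par x] is adjacent to the component of [x] and comes later, so its component in the longer
       prefix absorbs that of [x]. *)
    have sub : reach (pre x) x \subset reach (pre (par x)) (par x).
      move: pQ; rewrite inE => /andP[_ /existsP[z /andP[zc ezp]]].
      have zc' : z \in reach (pre (par x)) (par x).
        apply: (reach_step (x := par x)); rewrite ?reach_refl ?vpre // 1?e_sym //.
        have := subsetP (reach_sub (vpre x)) _ zc.
        by rewrite !inE => /leq_trans; apply; apply: ltnW.
      rewrite -(reach_eq zc') -(reach_eq zc); apply: reach_mono.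
      by apply/subsetP => y; rewrite !inE => /leq_trans; apply; apply: ltnW.
    move: vQ; rewrite inE => /andP[_ /existsP[z /andP[zc ezv]]].
    rewrite inE; apply/andP; split.
      apply: contraL rpv => /(subsetP (reach_sub (vpre _))).
      by rewrite inE -leqNgt.
    by apply/existsP; exists z; rewrite (subsetP sub).
  apply: (@connect_trans _ _ (par x)).
    apply: connect1; rewrite /= eqxx vB vBp !andbT.
    by apply: contraTneq rp => <-; rewrite ltnn.
  by apply: IH vBp; lia.
move=> x y vx vy; apply: (@connect_trans _ _ v); first exact: main vx.
by rewrite (sym_connect_sym Rsym); apply: main vy.
Qed.

(** The set [A] is arbitrary because the recursion below halves the boundary of a component rather
    than the component. *)
Definition balanced k := forall A : {set V}, exists2 S : {set V}, #|S| <= k &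
  forall v, v \notin S -> 2 * #|reach (~: S) v :&: A| <= #|A|.

(** The bound [2k+1] reproduces itself: a component of [E :\: X] borders on at most [k+1] vertices
    of [x |: S] and on at most half, hence [k], of the [2k+1] vertices of [nb E]. A vertex of [X],
    ordered after these components, sees at most [2k+1] vertices of [nb E] and [k] others of
    [x |: S], whence [3k+1]. *)
Lemma elimination_order k : balanced k -> forall D,
  (forall v, v \in D -> #|nb (reach D v)| <= (2 * k).+1) ->
  exists s : seq V, [/\ uniq s, s =i D & forall s1 v s2, s = s1 ++ v :: s2 ->
     #|nb (reach [set x in rcons s1 v] v)| <= (3 * k).+1].
Proof.
move=> bal D; have [n] := ubnP #|D|; elim: n D => // n IH D leD hD.
have [->|[x xD]] := set_0Vmem D.
  by exists [::]; split=> // [u|[]//]; rewrite inE.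
set E := reach D x.
have ED : E \subset D by apply: reach_sub.
have xE : x \in E by apply: reach_refl.
have [S Sk Sbal] := bal (nb E).
(* Including [x] makes the recursive call smaller even if [S] misses [E]. *)
pose X := (x |: S) :&: E.
have cX : #|x |: S| <= k.+1.
  by rewrite cardsU1; case: (_ \in _) => /=; lia.
have EhD := hD _ xD; rewrite -/E in EhD.
have xX : x \in X by rewrite !inE eqxx connect0.
have [||s' [us' ss' hs']] := IH (E :\: X).
- apply: leq_ltn_trans (_ : #|D :\ x| < n).
    apply/subset_leq_card/subsetP => u; rewrite in_setD => /andP[uX uE].
    by rewrite !inE (subsetP ED) // andbT; apply: contraNneq uX => ->.
  by move: leD; rewrite (cardsD1 x D) xD; lia.
- move=> v vD'; set F := reach _ v.
  have FD' : F \subset E :\: X by apply: reach_sub.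
  have FnS y : y \in F -> y \notin S.
    move=> /(subsetP FD'); rewrite in_setD => /andP[yX yE].
    by apply: contra yX => yS; rewrite in_setI yE andbT inE yS orbT.
  have sub : nb F \subset (x |: S) :|: (reach (~: S) v :&: nb E).
    apply/subsetP => u uF; have := nb_reach vD' uF => uD'.
    rewrite in_setU; have [//|uxS] := boolP (u \in x |: S) => /=.
    have uE : u \notin E.
      by apply: contra uD' => uE; rewrite in_setD uE in_setI (negbTE uxS).
    move: uF; rewrite inE => /andP[uF /existsP[y /andP[yF eyu]]].
    have yS := FnS _ yF.
    rewrite in_setI; apply/andP; split.
      apply: (reach_step (x := y)) => //.
      - by rewrite in_setC FnS // reach_refl.
      - apply: (subsetP (reach_mono _ _)) yF.
        apply/subsetP => z; rewrite in_setC in_setD => /andP[zX zE].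
        by apply: contra zX => zS; rewrite in_setI zE andbT inE zS orbT.
      - by rewrite in_setC; apply: contra uxS => uS; rewrite inE uS orbT.
    rewrite inE uE; apply/existsP; exists y; rewrite eyu andbT.
    by have := subsetP FD' _ yF; rewrite in_setD => /andP[].
  have vS : v \notin S by rewrite FnS // reach_refl.
  have := Sbal _ vS; have := subset_leq_card sub.
  have := leq_of_leqif (leq_card_setU (x |: S) (reach (~: S) v :&: nb E)).
  by lia.
have [||s3 [us3 ss3 hs3]] := IH (D :\: E).
- apply: leq_ltn_trans (_ : #|D :\ x| < n).
    apply/subset_leq_card/subsetP => u; rewrite in_setD => /andP[uE uD].
    by rewrite !inE uD andbT; apply: contraNneq uE => ->.
  by move: leD; rewrite (cardsD1 x D) xD; lia.
- move=> v vDE; suff <- : reach D v = reach (D :\: E) v.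
    by apply: hD; move: vDE; rewrite in_setD => /andP[].
  apply: reach_local => //; first exact: subsetDl.
  move=> y z; rewrite !in_setD => /andP[yE yD] zD eyz; rewrite zD andbT.
  by apply: contra yE => zE; apply: reach_step zE _ yD; rewrite // e_sym.
exists (s' ++ enum X ++ s3); split.
- rewrite !cat_uniq us' us3 enum_uniq /= andbT; apply/andP; split.
    apply/hasPn => u; rewrite mem_cat mem_enum ss3 ss' !in_setD.
    by case/orP=> [->//|/andP[/negbTE-> _]]; rewrite andbF.
  apply/hasPn => u; rewrite mem_enum ss3 in_setD => /andP[uE _].
  by rewrite /= in_setI (negbTE uE) andbF.
- move=> u; rewrite !mem_cat ss' ss3 mem_enum !in_setD.
  have [uX|uX] /= := boolP (u \in X).
    by rewrite (subsetP ED) //; move: uX; rewrite in_setI => /andP[].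
  have [uE|] := boolP (u \in E) => //=; by rewrite (subsetP ED).
move=> s1 v s2 Es; case: (cat_split Es) => [[s2' Es']|[s1' [-> Es']]].
  exact: hs' Es'.
case: (cat_split Es') => [[s2' EX]|[s3' [-> Es3]]].
  have memX u : (u \in X) = (u \in s1' ++ v :: s2') by rewrite -EX mem_enum.
  have vX : v \in X by rewrite memX mem_cat mem_head orbT.
  have s1'X u : u \in s1' -> u \in X by rewrite memX mem_cat => ->.
  set P := [set y in _]; have PE : P \subset E.
    apply/subsetP => u; rewrite inE mem_rcons in_cons mem_cat ss' in_setD.
    case/or3P => [/eqP->|/andP[]//|/s1'X]; first by move: vX; rewrite in_setI => /andP[].
    by rewrite in_setI => /andP[].
  have vP : v \in P by rewrite inE mem_rcons mem_head.
  have sub : nb (reach P v) \subset nb E :|: (x |: S) :\ v.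
    apply/subsetP => u uN; have uP := nb_reach vP uN.
    rewrite in_setU; have [uE|uE] := boolP (u \in E).
      apply/orP; right; rewrite in_setD1.
      have -> : u != v by apply: contraNneq uP => ->.
      rewrite andTb; apply: contraR uP => uxS; rewrite inE mem_rcons in_cons mem_cat ss' in_setD.
      by rewrite in_setI (negbTE uxS) uE !orbT.
    move: uN; rewrite inE => /andP[_ /existsP[y /andP[yc eyu]]].
    rewrite inE uE; apply/orP; left; apply/existsP; exists y; rewrite eyu andbT.
    exact: (subsetP (subset_trans (reach_sub vP) PE)).
  have vxS : v \in x |: S by move: vX; rewrite in_setI => /andP[].
  have := cX; rewrite (cardsD1 v) vxS => cX1.
  apply: leq_trans (subset_leq_card sub) _.
  apply: leq_trans (leq_of_leqif (leq_card_setU _ _)) _.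
  have {}cX1 : #|(x |: S) :\ v| <= k by rewrite -ltnS -add1n.
  by apply: leq_trans (leq_add EhD cX1) _; lia.
have vs3 : v \in D :\: E by rewrite -ss3 Es3 mem_cat mem_head orbT.
have s3'D u : u \in s3' -> u \in D :\: E by rewrite -ss3 Es3 mem_cat => ->.
rewrite (_ : reach _ v = reach [set y in rcons s3' v] v); first exact: hs3 Es3.
apply: reach_local.
- by rewrite inE mem_rcons mem_head.
- by apply/subsetP => u; rewrite !inE !mem_rcons !in_cons !mem_cat;
    case/orP => ->; rewrite ?orbT.
move=> y z; rewrite !inE !mem_rcons !in_cons !mem_cat => yT zP eyz.
have yDE : y \in D :\: E by case/orP: yT => [/eqP->//|/s3'D].
suff zE : z \notin E.
  case/or4P: zP => [->//|zs'|zX|->]; last by rewrite orbT.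
    by move: zE; rewrite ss' in zs'; move: zs'; rewrite in_setD => /andP[_ ->].
  by move: zE zX; rewrite mem_enum in_setI => /negbTE->; rewrite andbF.
move: yDE; rewrite in_setD => /andP[yE yD]; apply: contra yE => zE.
by apply: reach_step zE _ yD; rewrite // e_sym.
Qed.

Lemma treewidth_of_balanced k : 0 < #|V| -> irreflexive e -> balanced k ->
  exists (t : rel V) (B : V -> {set V}),
    tree_decomposition e t B /\ forall x, #|B x| <= (3 * k).+2.
Proof.
move=> V0 eirr bal.
have [|s [us sV hs]] := elimination_order bal (D := [set: V]).
  move=> v _; rewrite (_ : nb _ = set0) ?cards0 //.
  apply/setP => u; rewrite [RHS]in_set0; apply/negP.
  by move=> /(nb_reach (in_setT v)); rewrite in_setT.
apply: (@tree_decomp_of_order s) => // v.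
by rewrite sV in_setT.
Qed.
End Comp.

(** * Layerings of graphs of bounded arboricity *)

Section Forest.
Variable V : finType.

Definition degree_in (e : rel V) (U : {set V}) x := #|[set y in U | e x y]|.

(** If every vertex of [U] had two neighbours in [U], a path could always be prolonged at its front
    by a neighbour other than the preceding vertex: an old vertex would close a cycle, so paths of
    every length would exist. *)
Lemma acyclic_leaf (e : rel V) (U : {set V}) : symmetric e -> irreflexive e ->
  acyclic e -> U != set0 -> exists2 x, x \in U & degree_in e U x <= 1.
Proof.
move=> e_sym eirr eac /set0Pn[x0 x0U].
have [/existsP[x /andP[xU dx]]|noleaf] :=
  boolP [exists x in U, degree_in e U x <= 1]; first by exists x.
have deg2 x : x \in U -> 1 < degree_in e U x.
  move=> xU; rewrite ltnNge; apply: contra noleaf => dx.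
  by apply/existsP; exists x; rewrite xU.
have long n : exists x p, [/\ size p = n, path e x p, uniq (x :: p) &
    {subset x :: p <= U}].
  elim: n => [|n [x [p [sp pp up pU]]]].
    by exists x0, [::]; split=> // y; rewrite inE => /eqP->.
  have xU : x \in U by apply: pU; rewrite mem_head.
  have := deg2 x xU; rewrite /degree_in (cardsD1 (head x p)) => d2.
  have /card_gt0P[z] : 0 < #|[set y in U | e x y] :\ head x p|.
    by move: d2; case: (_ \in _) => /=; lia.
  rewrite !inE => /and3P[zh zU exz].
  have zx : z != x by apply: contraTneq exz => ->; rewrite eirr.
  have [zp|zp] := boolP (z \in p); last first.
    exists z, (x :: p); split=> //=; rewrite ?sp ?pp 1?e_sym ?exz //.
      by rewrite in_cons negb_or zx zp.
    by move=> y; rewrite in_cons => /predU1P[->//|/pU].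
  case/splitPr: zp sp pp up pU zh => p1 p2 _ pp up _ zh.
  have sz : 2 < size (x :: rcons p1 z).
    by case: p1 zh {pp up} => [|y p1] /=; rewrite ?eqxx // size_rcons.
  have u1 : uniq (x :: rcons p1 z).
    by move: up; rewrite -cat_rcons -cat_cons cat_uniq => /andP[].
  have := eac _ u1 sz; rewrite /cycle rcons_path last_rcons e_sym exz andbT.
  by move: pp; rewrite -cat_rcons cat_path => /andP[->].
have [x [p [sp _ up _]]] := long #|V|.
by have := uniq_leq_size up (fun y _ => mem_enum V y); rewrite -cardE /= sp ltnn.
Qed.

(** Deleting a vertex of degree at most 1 lowers the sum by twice its degree and the bound by 2. *)
Lemma acyclic_degree_sum (e : rel V) (U : {set V}) : symmetric e ->
  irreflexive e -> acyclic e -> \sum_(x in U) degree_in e U x <= 2 * #|U|.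
Proof.
move=> e_sym eirr eac; have [n] := ubnP #|U|; elim: n U => // n IH U leU.
have [->|U0] := eqVneq U set0; first by rewrite big_set0.
have [x xU dx] := acyclic_leaf e_sym eirr eac U0.
have cU : #|U| = #|U :\ x|.+1 by rewrite (cardsD1 x) xU.
rewrite (big_setD1 x) //=.
have E y : y \in U :\ x -> degree_in e U y = e y x + degree_in e (U :\ x) y.
  move=> _; rewrite /degree_in (cardsD1 x) !inE xU /=; congr (_ + _).
  by apply: eq_card => z; rewrite !inE andbA.
rewrite (eq_bigr _ E) big_split /=.
have -> : \sum_(y in U :\ x) e y x = degree_in e U x.
  rewrite /degree_in (cardsD1 x) !inE eirr andbF add0n -sum1_card.
  rewrite big_mkcond [RHS]big_mkcond /=; apply: eq_bigr => y _.
  by rewrite !inE e_sym; case: (y == x); case: (y \in U); case: (e x y).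
by have := IH (U :\ x); lia.
Qed.

Variables (e : rel V) (a : nat).
Hypotheses (e_sym : symmetric e) (eirr : irreflexive e).
Hypothesis ea : forest_partition e a.

Lemma degree_sum (U : {set V}) : \sum_(x in U) degree_in e U x <= 2 * a * #|U|.
Proof.
have [col [col_sym [col_lt col_ac]]] := ea.
pose ei (i : 'I_a) := [rel u v | e u v && (col u v == i)].
have E x : degree_in e U x = \sum_(i < a) degree_in (ei i) U x.
  rewrite /degree_in -sum1_card big_mkcond /=.
  under [RHS]eq_bigr => i _ do rewrite -sum1_card big_mkcond /=.
  rewrite exchange_big /=; apply: eq_bigr => y _; rewrite inE.
  have [yU|yU] := boolP (y \in U); last first.
    by rewrite big1 // => i _; rewrite inE (negbTE yU).
  have [exy|exy] := boolP (e x y); last first.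
    by rewrite big1 // => i _; rewrite inE /= (negbTE exy) andbF.
  rewrite (bigD1 (Ordinal (col_lt _ _ exy))) //= inE yU /= exy eqxx /=.
  rewrite big1 // => i ine; rewrite inE yU /= exy /=.
  by case: eqP => // ci; case/eqP: ine; apply: val_inj.
under eq_bigr => x _ do rewrite E.
rewrite exchange_big /=.
apply: (@leq_trans (\sum_(i < a) 2 * #|U|)); last first.
  by rewrite sum_nat_const card_ord; lia.
apply: leq_sum => i _; apply: acyclic_degree_sum.
- by move=> x y; rewrite /= e_sym col_sym.
- by move=> x; rewrite /= eirr.
- exact: col_ac.
Qed.

(** In a clique of size [m] the degrees add up to [m (m - 1)], which is at most [2 a m]. *)
Lemma clique_bound (U : {set V}) :
  {in U &, forall x y, x != y -> e x y} -> #|U| <= (2 * a).+1.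
Proof.
move=> cl; have [->|/set0Pn[x0 x0U]] := eqVneq U set0; first by rewrite cards0.
have U0 : 0 < #|U| by apply/card_gt0P; exists x0.
have := degree_sum U; rewrite (eq_bigr (fun=> #|U|.-1)) => [|x xU].
  by rewrite sum_nat_const; nia.
rewrite [in RHS](cardsD1 x) xU /=; apply: eq_card => y; rewrite !inE.
have [->|yx] := eqVneq y x; first by rewrite eirr andbF.
by have [yU|//] := boolP (y \in U); rewrite cl // eq_sym.
Qed.

(** The threshold is twice the bound [2 a] on the average degree, so at most half of the vertices
    survive each round. *)
Fixpoint peel (i : nat) : {set V} :=
  if i is j.+1 then [set x in peel j | 4 * a <= degree_in e (peel j) x]
  else [set: V].

Lemma peel_half i : 0 < a -> 2 * #|peel i.+1| <= #|peel i|.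
Proof.
move=> a0; have := degree_sum (peel i).
have : \sum_(x in peel i.+1) 4 * a <= \sum_(x in peel i) degree_in e (peel i) x.
  rewrite big_mkcond [leqRHS]big_mkcond /=; apply: leq_sum => x _.
  by rewrite !inE; case: (_ \in _) => //=; case: ifP.
by rewrite sum_nat_const; nia.
Qed.

Lemma peel_card i : 0 < a -> 2 ^ i * #|peel i| <= #|V|.
Proof.
move=> a0; elim: i => [|i IH]; first by rewrite mul1n max_card.
by have := peel_half i a0; rewrite expnS; nia.
Qed.

Lemma peel_sub i j : i <= j -> peel j \subset peel i.
Proof.
move=> /subnK <-; elim: (j - i) => // k IH; apply: subset_trans IH.
by apply/subsetP => x; rewrite addSn inE => /andP[].
Qed.

(** The vertex itself is included because the string being followed counts among the strings met. *)
Definition up_nbrs (lay : V -> nat) x : {set V} :=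
  [set y | (y == x) || e x y && (lay x <= lay y)].

Lemma in_up_nbrs lay x y :
  (y \in up_nbrs lay x) = (y == x) || e x y && (lay x <= lay y).
Proof. by rewrite inE. Qed.

(** The layer of [x] is the last [i] with [x] in [peel i]. Neighbours in the same or higher layers
    all lie in [peel i], where [x] has degree less than [4 a]; adding [x] itself gives [4 a]. *)
Lemma layering l : 0 < a -> #|V| < 2 ^ l -> exists lay : V -> nat,
  (forall x, lay x < l) /\
  forall x, #|up_nbrs lay x| <= 4 * a.
Proof.
move=> a0 Vl.
have pl : peel l = set0.
  have := peel_card l a0; have [->//|/set0Pn[x xl]] := eqVneq (peel l) set0.
  by have : 0 < #|peel l| by [apply/card_gt0P; exists x]; nia.
have ex x : exists i, x \notin peel i.+1.
  exists l; apply/negP => /(subsetP (peel_sub (leqnSn l))).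
  by rewrite pl inE.
have layP x : { i | x \notin peel i.+1 & x \in peel i }.
  case: (ex_minnP (ex x)) => i xi mini; exists i => //.
  case: i xi mini => [|i] xi mini; first by rewrite inE.
  by apply: contraT => xi'; have := mini i xi'; rewrite ltnn.
pose lay x := s2val (layP x).
have lay_in x : x \in peel (lay x) := s2valP' (layP x).
have lay_out x : x \notin peel (lay x).+1 := s2valP (layP x).
exists lay; split=> x.
  rewrite ltnNge; apply/negP => /peel_sub/subsetP/(_ _ (lay_in x)).
  by rewrite pl inE.
have dx : degree_in e (peel (lay x)) x < 4 * a.
  by have := lay_out x; rewrite inE lay_in /= -ltnNge.
have sub : up_nbrs lay x \subset x |: [set y in peel (lay x) | e x y].
  apply/subsetP => y; rewrite in_up_nbrs !inE => /orP[->//|/andP[-> xy]].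
  by rewrite andbT (subsetP (peel_sub xy)) ?orbT.
have := subset_leq_card sub; rewrite cardsU1 !inE eirr andbF.
by move=> le1; apply: leq_trans le1 _; rewrite add1n.
Qed.
End Forest.

(** * Heavy components in the absence of balanced separators *)

Section Haven.
Variables (V : finType) (e : rel V).
Hypothesis e_sym : symmetric e.

Lemma majorities_meet (A D D' : {set V}) : #|A| < 2 * #|D :&: A| ->
  #|A| < 2 * #|D' :&: A| -> exists x, x \in D :&: D'.
Proof.
move=> DA DA'; apply/set0Pn; apply: contraTneq DA => dis; rewrite -leqNgt.
have sub : D :&: A :|: D' :&: A \subset A by rewrite subUset !subsetIr.
have := subset_leq_card sub; rewrite cardsU.
rewrite (_ : _ :&: A :&: _ = set0) ?cards0; first by lia.
by rewrite setIACA dis set0I.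
Qed.

(** Fix a set [A] that no small [S] splits evenly: each small [S] leaves a component with more than
    half of [A], and [beta S] is a vertex of it. Two majorities of [A] share a vertex, so the heavy
    components of nested sets are nested. This is a haven in the sense of graph minor theory. *)
Lemma not_balanced_haven k : ~ balanced e k -> exists beta : {set V} -> V,
  forall S : {set V}, #|S| <= k -> beta S \notin S /\
    forall S' : {set V}, (forall v, v \in S -> v \in S') -> #|S'| <= k ->
      beta S' \in reach e (~: S) (beta S).
Proof.
move=> nbal.
have [A /forallP hA] : exists A : {set V}, [forall S : {set V}, (#|S| <= k) ==>
    [exists v, (v \notin S) && (#|A| < 2 * #|reach e (~: S) v :&: A|)]].
  apply/existsP; apply: contraT => /existsPn nA; case: nbal => A.
  have /forallPn[S] := nA A; rewrite negb_imply => /andP[Sk /existsPn hS].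
  by exists S => // v vS; have := hS v; rewrite vS /= -leqNgt.
have [v0 _] : exists v : V, true.
  have /existsP[v _] := implyP (hA set0) (leq_trans (eq_leq (cards0 _)) (leq0n k)).
  by exists v.
pose beta (S : {set V}) := odflt v0 [pick v | (v \notin S) && (#|A| < 2 * #|reach e (~: S) v :&: A|)].
have betaP (S : {set V}) : #|S| <= k ->
    (beta S \notin S) /\ #|A| < 2 * #|reach e (~: S) (beta S) :&: A|.
  move=> Sk; rewrite /beta; case: pickP => [v /andP[]//|none].
  by have /existsP[v] := implyP (hA S) Sk; rewrite none.
exists beta => S Sk; have [bS bA] := betaP S Sk; split=> // S' SS' S'k.
have [bS' bA'] := betaP S' S'k.
have sub : reach e (~: S') (beta S') \subset reach e (~: S) (beta S').
  by apply: reach_mono; apply/subsetP => v; rewrite !in_setC; apply: contra => /SS'.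
have [x] := majorities_meet bA bA'.
rewrite in_setI => /andP[xS xS'].
have xS2 := subsetP sub _ xS'.
by rewrite -(reach_eq e_sym xS) (reach_eq e_sym xS2) reach_refl.
Qed.
End Haven.

Definition setof (V : finType) (P : pred V) : {set V} := [set v | P v].

Lemma in_setof (V : finType) (P : pred V) v : (v \in setof P) = P v.
Proof. by rewrite inE. Qed.

Lemma edgeless_treewidth (V : finType) (e : rel V) : 0 < #|V| ->
  (forall u v, ~~ e u v) -> exists (t : rel V) (B : V -> {set V}),
    tree_decomposition e t B /\ forall x, #|B x| <= 1.
Proof.
move=> V0 e0; apply: (@tree_decomp_of_order V e _ (enum V)) => //.
- by move=> u v; rewrite (negbTE (e0 u v)) (negbTE (e0 v u)).
- exact: enum_uniq.
- by move=> v; rewrite mem_enum.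
- by move=> v; apply: negbTE.
move=> s1 v s2 _; rewrite leqn0 cards_eq0; apply/eqP/setP => u; rewrite inE in_set0.
by apply/negP => /andP[_ /existsP[x /andP[_]]]; rewrite (negbTE (e0 x u)).
Qed.

Lemma card_le_union (V : finType) (A B D : {set V}) m n :
  (forall v, v \in D -> v \in A \/ v \in B) -> #|A| <= m -> #|B| <= n ->
  #|D| <= m + n.
Proof.
move=> DAB Am Bn; have sub : D \subset A :|: B.
  by apply/subsetP => v /DAB vAB; rewrite in_setU; apply/orP.
have := subset_leq_card sub; have := leq_of_leqif (leq_card_setU A B); lia.
Qed.

Lemma card_le_sub (V : finType) (A B : {set V}) :
  (forall v, v \in A -> v \in B) -> #|A| <= #|B|.
Proof. by move=> AB; apply/subset_leq_card/subsetP. Qed.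

Lemma reach_ind_path (V : finType) (e : rel V) (S : {set V}) (P : V -> Prop) v u :
  v \notin S -> u \in reach e (~: S) v -> P v ->
  (forall x y, x \notin S -> y \notin S -> e x y -> P x -> P y) -> P u /\ u \notin S.
Proof.
move=> vS; rewrite inE => /connectP[p pth ->] + step.
elim: p v vS pth => [|y p IH] v vS //= /andP[/and3P[evy _ yS] pth] Pv.
by rewrite in_setC in yS; apply: IH pth _ => //; apply: step Pv.
Qed.

From mathcomp Require Import all_classical all_reals all_analysis.
From mathcomp Require Import ring lra.
Import numFieldNormedType.Exports.
Local Open Scope classical_set_scope.
Local Open Scope ring_scope.

(** * Angles in the plane *)

Section Angles.
Variable R : realType.
Local Notation pt := (R * R)%type.
Implicit Types (x y z v w : pt) (s t : R).

Definition dot x y := x.1 * y.1 + x.2 * y.2.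
Definition cross x y := x.1 * y.2 - x.2 * y.1.
(** The two conditions say that [v] is a positive multiple of [(cos t, sin t)]. *)
Definition is_arg v t :=
  v.1 * sin t = v.2 * cos t /\ 0 < v.1 * cos t + v.2 * sin t.
(** The signed angle from [x] to [y], meaningful when [dot x y] is positive. *)
Definition ang x y := atan (cross x y / dot x y).

Lemma dotC x y : dot x y = dot y x.
Proof. by rewrite /dot mulrC [y.1 * _]mulrC [x.2 * _]mulrC; congr (_ + _); ring. Qed.

Lemma ang_bound x y : - (pi / 2) < ang x y < pi / 2.
Proof. by rewrite /ang atan_gtNpi2 atan_ltpi2. Qed.

Lemma angC x y : ang y x = - ang x y.
Proof.
rewrite /ang -atanN; congr atan; rewrite dotC -mulNr; congr (_ / _).
by rewrite /cross; ring.
Qed.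

Lemma angxx x : ang x x = 0.
Proof. by rewrite /ang /cross [x.1 * _]mulrC subrr mul0r atan0. Qed.

Lemma arg_ang x y t : is_arg x t -> 0 < dot x y -> is_arg y (t + ang x y).
Proof.
move=> [xs xc] d0.
have ca : 0 < cos (ang x y) by apply: cos_gt0_pihalf; exact: ang_bound.
have sa : sin (ang x y) * dot x y = cos (ang x y) * cross x y.
  have : tan (ang x y) = cross x y / dot x y by rewrite /ang atanK.
  rewrite /tan => /(congr1 (fun r => r * cos (ang x y) * dot x y)).
  rewrite mulfVK ?gt_eqF // => ->.
  by rewrite mulrAC divfK ?gt_eqF // mulrC.
have sc := cos2Dsin2 t.
set rho := x.1 * cos t + x.2 * sin t in xc.
have x1 : x.1 = rho * cos t.
  rewrite /rho mulrDl -mulrA -expr2 -[x.2 * _ * _]mulrAC -xs -mulrA -expr2.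
  by rewrite -mulrDr sc mulr1.
have x2 : x.2 = rho * sin t.
  rewrite /rho mulrDl -[x.1 * _ * _]mulrAC xs -!mulrA -mulrDr -!expr2.
  by rewrite sc mulr1.
move: sa ca d0; clearbody rho; rewrite /dot /cross x1 x2; set c := cos (ang x y); set u := sin (ang x y).
move=> sa ca d0.
have dr : 0 < y.1 * cos t + y.2 * sin t.
  have -> : y.1 * cos t + y.2 * sin t = (rho * cos t * y.1 + rho * sin t * y.2) / rho.
    by field; rewrite gt_eqF.
  exact: divr_gt0.
have {}sa : u * (y.1 * cos t + y.2 * sin t) = c * (y.2 * cos t - y.1 * sin t).
  have r0 : rho != 0 by rewrite gt_eqF.
  apply: (mulfI r0).
  transitivity (u * (rho * cos t * y.1 + rho * sin t * y.2)); first by ring.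
  by rewrite sa; ring.
rewrite /is_arg sinD cosD -/c -/u; split.
  have E : y.1 * (sin t * c + cos t * u) - y.2 * (cos t * c - sin t * u) =
     u * (y.1 * cos t + y.2 * sin t) - c * (y.2 * cos t - y.1 * sin t) by ring.
  by apply/eqP; rewrite -subr_eq0 E sa subrr.
have -> : y.1 * (cos t * c - sin t * u) + y.2 * (sin t * c + cos t * u) =
  c * (y.1 * cos t + y.2 * sin t) + u * (y.2 * cos t - y.1 * sin t) by ring.
rewrite -(pmulr_rgt0 _ ca) mulrDr [c * (u * _)]mulrCA -sa.
rewrite mulrA [u * (u * _)]mulrA -mulrDl; apply: mulr_gt0 => //.
by rewrite ltr_pwDl // ?mulr_gt0 // -expr2 sqr_ge0.
Qed.

Lemma arg_uniq v s t : is_arg v s -> is_arg v t -> cos (s - t) = 1.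
Proof.
move=> [s1 s2] [t1 t2].
have ss := cos2Dsin2 s; have tt := cos2Dsin2 t.
have sn : sin (s - t) = 0.
  have r0 : v.1 * cos s + v.2 * sin s != 0 by rewrite gt_eqF.
  apply: (mulfI r0); rewrite mulr0 sinB.
  have -> : (v.1 * cos s + v.2 * sin s) * (sin s * cos t - cos s * sin t) =
    (v.1 * sin s - v.2 * cos s) * (cos s * cos t + sin s * sin t) +
    (cos s ^+ 2 + sin s ^+ 2) * (v.2 * cos t - v.1 * sin t) by ring.
  by rewrite s1 t1 !subrr mul0r mulr0 addr0.
have c0 : 0 < cos (s - t).
  rewrite cosB -(pmulr_rgt0 _ t2).
  have -> : (v.1 * cos t + v.2 * sin t) * (cos s * cos t + sin s * sin t) =
   (v.1 * cos s + v.2 * sin s) * (cos t ^+ 2 + sin t ^+ 2) +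
   (v.1 * sin t - v.2 * cos t) * (sin s * cos t - cos s * sin t) by ring.
  by rewrite tt t1 subrr mul0r addr0 mulr1.
by have := sin0cos1 sn; rewrite gtr0_norm.
Qed.

Lemma cos1_small t : cos t = 1 -> `|t| < 2 * pi -> t = 0.
Proof.
rewrite -(cos_norm t) => c1 tlt.
have : sin (`|t| / 2) = 0.
  have := cos_mulr2n (`|t| / 2); rewrite !mulr2n -splitr c1 cos2sin2 => E.
  by apply/eqP; rewrite -sqrf_eq0; apply/eqP; lra.
have [->//|t0] := eqVneq t 0.
have h : 0 < `|t| / 2 < pi by rewrite divr_gt0 ?normr_gt0 //=; lra.
by move=> s0; have := sin_gt0_pi h; rewrite s0 ltxx.
Qed.

(** A nonzero vector has positive inner product with one of the four axis directions, whose
    arguments are known. *)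
Lemma arg_exists v : v != 0 -> exists t, is_arg v t.
Proof.
move=> v0.
have a1 : is_arg (1, 0) 0 by rewrite /is_arg /= sin0 cos0; split; lra.
have a2 : is_arg (0, 1) (pi / 2).
  by rewrite /is_arg /= sin_pihalf cos_pihalf; split; lra.
have a3 : is_arg (-1, 0) pi by rewrite /is_arg /= sinpi cospi; split; lra.
have a4 : is_arg (0, -1) (- (pi / 2)).
  by rewrite /is_arg /= sinN cosN sin_pihalf cos_pihalf; split; lra.
have [v1|v1|v1] := ltgtP v.1 0.
- by eexists; apply: (arg_ang a3); rewrite /dot /=; lra.
- by eexists; apply: (arg_ang a1); rewrite /dot /=; lra.
have [v2|v2|v2] := ltgtP v.2 0.
- by eexists; apply: (arg_ang a4); rewrite /dot /=; lra.
- by eexists; apply: (arg_ang a2); rewrite /dot /=; lra.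
by case/eqP: v0; rewrite [v]surjective_pairing v1 v2.
Qed.

(** Both sides agree modulo [2 pi], and the bounds [3 pi / 2] and [pi / 2] keep their difference
    below a full turn. *)
Lemma arg_diff_ang x y s t : is_arg x s -> is_arg y t -> 0 < dot x y ->
  `|t - s| < 3 * pi / 2 -> t - s = ang x y.
Proof.
move=> xs yt d0 ts; have ys := arg_ang xs d0.
have c1 := arg_uniq yt ys; have /andP[b1 b2] := ang_bound x y.
apply/eqP; rewrite -subr_eq0; apply/eqP/cos1_small.
  by rewrite -c1; congr cos; ring.
by move: ts; rewrite !ltr_norml => /andP[? ?]; apply/andP; split; lra.
Qed.

(** Two turns of less than a quarter each make less than a half turn, so no multiple of [2 pi] can
    appear. *)
Lemma ang_add x y z : 0 < dot x y -> 0 < dot y z -> 0 < dot x z ->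
  ang x y + ang y z = ang x z.
Proof.
move=> xy yz xz.
have x0 : x != 0.
  by apply: contraTneq xy => ->; rewrite /dot /= !mul0r addr0 ltxx.
have [t xt] := arg_exists x0.
have zt := arg_ang (arg_ang xt xy) yz.
have /andP[b1 b2] := ang_bound x y; have /andP[b3 b4] := ang_bound y z.
have := pi_gt0 R => pi0.
rewrite -(arg_diff_ang xt zt xz); first by ring.
by rewrite ltr_norml; apply/andP; split; lra.
Qed.

Lemma arg_opp v t : is_arg v t -> is_arg (- v) (t + pi).
Proof.
by move=> [s c]; rewrite /is_arg /= sinDpi cosDpi; split; lra.
Qed.

Lemma arg_sin0 v w s t : is_arg v s -> is_arg w t -> w = v \/ w = - v ->
  sin (s - t) = 0.
Proof.
move=> vs wt [E|E]; rewrite E in wt.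
  by have := arg_uniq vs wt; move=> c1; apply: cos1sin0; rewrite c1 normr1.
have := arg_uniq (arg_opp vs) wt.
rewrite (_ : s + pi - t = s - t + pi) ?cosDpi; last by ring.
by move=> c1; apply: cos1sin0; rewrite -normrN c1 normr1.
Qed.

(** Near [k a] the sine vanishes only at [k a] itself, up to distance [pi]; by the intermediate
    value theorem a function with [k a] different from [k b] would take another value within
    distance 1 of [k a]. *)
Lemma sin0_constant (k : R -> R) (a b : R) : a <= b ->
  {within `[a, b], continuous k} -> (forall t, t \in `[a, b] -> sin (k t) = 0) ->
  k a = k b.
Proof.
move=> ab kc k0.
have sN c : `|c - k a| < pi -> c != k a -> sin c != 0.
  move=> cp ck.
  have ka0 : sin (k a) = 0 by apply: k0; rewrite in_itv /= lexx.
  have -> : c = k a + (c - k a) by ring.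
  rewrite sinD ka0 mul0r add0r mulf_neq0 //.
    by rewrite -normr_eq0 (sin0cos1 ka0) oner_eq0.
  set d := c - k a in cp *; have d0 : d != 0 by rewrite subr_eq0.
  have : 0 < sin `|d| by apply: sin_gt0_pi; rewrite normr_gt0 d0.
  have [dl|dg] := ltP d 0; last by rewrite ger0_norm // => /gt_eqF->.
  by rewrite ltr0_norm // sinN oppr_gt0 => /lt_eqF->.
have pi0 := pi_gt0 R.
have go (v : R) : Num.min (k a) (k b) <= v <= Num.max (k a) (k b) -> `|v - k a| < pi ->
    v = k a.
  move=> vm vp; have [c cab kcv] := IVT ab kc vm.
  apply/eqP; apply: contraT => /(sN _ vp); rewrite -kcv k0 // eqxx //.
have [lt|gt|//] := ltgtP (k a) (k b).
- have := go (Num.min (k b) (k a + 1)); rewrite (min_idPl (ltW lt)) (max_idPr (ltW lt)).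
  have := pi_ge2 R; case: (leP (k b) (k a + 1)) => h pi2 /(_ _ _)/=.
    by move=> H; symmetry; apply: H; [rewrite lexx ltW|rewrite ltr_norml; lra].
  move=> H; suff: k a + 1 = k a by lra.
  by apply: H; [apply/andP; split; lra|rewrite ltr_norml; lra].
- have := go (Num.max (k b) (k a - 1)); rewrite (min_idPr (ltW gt)) (max_idPl (ltW gt)).
  have := pi_ge2 R; case: (leP (k a - 1) (k b)) => h pi2 /(_ _ _)/=.
    by move=> H; symmetry; apply: H; [rewrite lexx ltW|rewrite ltr_norml; lra].
  move=> H; suff: k a - 1 = k a by lra.
  by apply: H; [apply/andP; split; lra|rewrite ltr_norml; lra].
Qed.

End Angles.

(** * Continuity and compactness in the plane *)

Section Plane.
Variable R : realType.
Local Notation pt := (R * R)%type.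

Lemma ballR (x d y : R) : ball x d y <-> `|x - y| < d.
Proof. by rewrite -ball_normE. Qed.

Lemma ballP2 (x y : pt) d : ball x d y <-> `|x.1 - y.1| < d /\ `|x.2 - y.2| < d.
Proof. by split=> [[/ballR ? /ballR ?]|[? ?]]; split => //; apply/ballR. Qed.

Lemma cont_eps (T S : pseudoMetricType R) (f : T -> S) :
  continuous f <-> forall x e, 0 < e -> exists2 d, 0 < d &
    forall y, ball x d y -> ball (f x) e (f y).
Proof.
split=> [fc x e e0|H x].
  have /cvg_ballP/(_ _ e0)/nbhs_ballP[d /= d0 dP] := fc x.
  by exists d.
apply/cvg_ballP => e e0; have [d d0 dP] := H x e e0.
by apply/nbhs_ballP; exists d.
Qed.

Lemma within_eps (T S : pseudoMetricType R) (A : set T) (f : T -> S) :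
  {within A, continuous f} <-> forall x e, A x -> 0 < e -> exists2 d, 0 < d &
    forall y, A y -> ball x d y -> ball (f x) e (f y).
Proof.
rewrite subspace_continuousP; split=> [fc x e Ax e0|H x Ax].
  have /cvg_ballP/(_ _ e0)/nbhs_ballP[d /= d0 dP] := fc x Ax.
  by exists d => // y Ay xy; apply: dP.
apply/cvg_ballP => e e0; have [d d0 dP] := H x e Ax e0.
by apply/nbhs_ballP; exists d => // y xy Ay; apply: dP.
Qed.

Lemma within_comp (T S U : pseudoMetricType R) (A : set S) (f : S -> U)
    (h : T -> S) (B : set T) :
  {within A, continuous f} -> {within B, continuous h} ->
  (forall t, B t -> A (h t)) -> {within B, continuous (f \o h)}.
Proof.
move=> /within_eps fc /within_eps hc hA; apply/within_eps => x e Bx e0.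
have [d d0 dP] := fc _ _ (hA _ Bx) e0; have [d' d'0 d'P] := hc _ _ Bx d0.
by exists d' => // y By xy; apply: dP; [apply: hA|apply: d'P].
Qed.

Lemma cont_within (T S : topologicalType) (A : set T) (f : T -> S) :
  continuous f -> {within A, continuous f}.
Proof. by move=> fc; apply: continuous_subspaceT. Qed.

Lemma within_sub (T S : pseudoMetricType R) (A B : set T) (f : T -> S) :
  A `<=` B -> {within B, continuous f} -> {within A, continuous f}.
Proof.
move=> AB /within_eps fc; apply/within_eps => x e Ax e0.
have [d d0 dP] := fc x e (AB _ Ax) e0; exists d => // y Ay; apply: dP; exact: AB.
Qed.

Lemma within_cont (T S U : pseudoMetricType R) (A : set S) (f : S -> U)
    (h : T -> S) :
  {within A, continuous f} -> continuous h -> (forall t, A (h t)) ->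
  continuous (f \o h).
Proof.
move=> /within_eps fc /cont_eps hc hA; apply/cont_eps => x e e0.
have [d d0 dP] := fc _ _ (hA x) e0; have [d' d'0 d'P] := hc x _ d0.
by exists d' => // y xy; apply: dP => //; apply: d'P.
Qed.

Lemma cont_comp (T S U : topologicalType) (f : S -> U) (h : T -> S) :
  continuous f -> continuous h -> continuous (fun t => f (h t)).
Proof. by move=> fc hc x; apply: continuous_comp; [apply: hc|apply: fc]. Qed.

Lemma cont_pair (T : topologicalType) (f g : T -> R) :
  continuous f -> continuous g -> continuous (fun t => (f t, g t)).
Proof. by move=> fc gc x; exact: (cvg_pair (fc x) (gc x)). Qed.

Lemma cont_fst (T : topologicalType) (f : T -> pt) :
  continuous f -> continuous (fun t => (f t).1).
Proof. by move=> fc x; apply: (cvg_comp _ _ (fc x)); apply: cvg_fst. Qed.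

Lemma cont_snd (T : topologicalType) (f : T -> pt) :
  continuous f -> continuous (fun t => (f t).2).
Proof. by move=> fc x; apply: (cvg_comp _ _ (fc x)); apply: cvg_snd. Qed.

(** The common form of the compactness arguments below: uniform continuity, injectivity of [C] away
    from the diagonal, and the distance between disjoint strings. *)
Lemma compact_uniform (T : pseudoMetricType R) (A : set T) (P : R -> T -> Prop) :
  compact A ->
  (forall x, A x -> exists2 e, 0 < e &
     forall y d, ball x e y -> 0 < d < e -> P d y) ->
  exists2 d, 0 < d & forall x, A x -> P d x.
Proof.
move=> /compact_near_coveringP cA H.
have := cA R (0^'+) P _ _.
case=> [x Ax|e /= e0 He].
  have [e e0 eP] := H x Ax.
  exists (ball x e, [set d | 0 < d < e]).
    split; first by apply/nbhs_ballP; exists e.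
    exists e => //= d /=; rewrite sub0r normrN => de d0.
    by rewrite d0 /=; apply: le_lt_trans de; apply: ler_norm.
  by move=> [y d] /= [xy de]; apply: eP.
exists (e / 2); first by rewrite divr_gt0.
apply: He; last by rewrite divr_gt0.
by rewrite /= sub0r normrN gtr0_norm ?divr_gt0 // gtr_pMr // invf_lt1 ?ltr1n.
Qed.

(** The retraction of the line onto [[0, 1]]; composing with it turns continuity within the interval
    into continuity everywhere. *)
Definition clamp (t : R) := Num.max 0 (Num.min 1 t).

Lemma clampP t : 0 <= clamp t <= 1.
Proof. by rewrite /clamp le_max lexx /= ge_max ler01 ge_min lexx. Qed.

Lemma clamp_id t : 0 <= t <= 1 -> clamp t = t.
Proof.
case/andP=> t0 t1; rewrite /clamp.
by case: (leP 1 t) => ?; case: leP => ?; lra.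
Qed.

Lemma clampK t : clamp (clamp t) = clamp t.
Proof. exact: clamp_id (clampP t). Qed.

Lemma clamp0 : clamp 0 = 0. Proof. by rewrite clamp_id // lexx ler01. Qed.
Lemma clamp1 : clamp 1 = 1. Proof. by rewrite clamp_id // lexx ler01. Qed.

Lemma clamp_cont : continuous clamp.
Proof.
apply/cont_eps => x e e0; exists e => // y /ballR xy; apply/ballR.
apply: le_lt_trans xy; rewrite /clamp; have := ler_norm (x - y).
have := ler_norm (y - x); rewrite (distrC y x) => ? ?; rewrite ler_norml.
by case: (leP 1 x) => ?; case: (leP 1 y) => ?; rewrite ?(max_idPr ler01) //;
  [|case: (leP 0 y) => ?|case: (leP 0 x) => ?|
    case: (leP 0 x) => ?; case: (leP 0 y) => ?]; apply/andP; split; lra.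
Qed.

Lemma clamp_in t : clamp t \in `[0, 1].
Proof. by rewrite in_itv /= clampP. Qed.

Definition clamp2 (x : pt) : pt := (clamp x.1, clamp x.2).

Lemma ang_cont (T : topologicalType) (f g : T -> pt) x : continuous f ->
  continuous g -> 0 < dot (f x) (g x) -> {for x, continuous (fun t => ang (f t) (g t))}.
Proof.
move=> fc gc d0.
have f1 := @cont_fst _ _ fc x; have f2 := @cont_snd _ _ fc x.
have g1 := @cont_fst _ _ gc x; have g2 := @cont_snd _ _ gc x.
rewrite /ang; apply: continuous_comp; last exact: continuous_atan.
apply: cvgM; first by apply: cvgB; apply: cvgM.
apply: cvgV; first by rewrite gt_eqF.
by apply: cvgD; apply: cvgM.
Qed.

(** A coordinate of size at least [e] contributes at least [3 e^2 / 4], while the other product is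
    never below [- e^2 / 64]. *)
Lemma dot_pos (u v : pt) (e : R) : 0 < e -> (e <= `|u.1| \/ e <= `|u.2|) ->
  `|u.1 - v.1| < e / 4 -> `|u.2 - v.2| < e / 4 -> 0 < dot u v.
Proof.
have aux (a b : R) : 0 < e -> `|a - b| < e / 4 -> - (e ^+ 2) / 64 <= a * b.
  move=> e0 ab; have -> : a * b = a ^+ 2 - a * (a - b) by ring.
  have : a * (a - b) <= `|a| * (e / 4).
    apply: le_trans (ler_norm _) _; rewrite normrM.
    by apply: ler_wpM2l => //; apply: ltW.
  have : a ^+ 2 = `|a| ^+ 2 by rewrite real_normK ?num_real.
  move: `|a| => A -> h; have := sqr_ge0 (A - e / 8).
  have -> : (A - e / 8) ^+ 2 = A ^+ 2 - A * (e / 4) + e ^+ 2 / 64 by field.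
  lra.
have aux2 (a b : R) : 0 < e -> e <= `|a| -> `|a - b| < e / 4 ->
    e ^+ 2 * 3 / 4 <= a * b.
  move=> e0 ea ab; have -> : a * b = a ^+ 2 - a * (a - b) by ring.
  have : a * (a - b) <= `|a| * (e / 4).
    apply: le_trans (ler_norm _) _; rewrite normrM.
    by apply: ler_wpM2l => //; apply: ltW.
  have : a ^+ 2 = `|a| ^+ 2 by rewrite real_normK ?num_real.
  move: `|a| ea => A eA -> h.
  have : 0 <= (A - e) * (A + e * 3 / 4) by apply: mulr_ge0; lra.
  have -> : (A - e) * (A + e * 3 / 4) = A ^+ 2 - A * (e / 4) - e ^+ 2 * 3 / 4 by field.
  lra.
move=> e0 ue d1 d2; rewrite /dot; have : 0 < e ^+ 2 by rewrite exprn_gt0.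
have := aux _ _ e0 d1; have := aux _ _ e0 d2.
by case: ue => ue; [have := aux2 _ _ e0 ue d1|have := aux2 _ _ e0 ue d2]; lra.
Qed.

Lemma dot_near (x : pt) : x != 0 -> exists2 e, 0 < e &
  forall y z, ball x e y -> ball x e z -> 0 < dot y z.
Proof.
move=> x0; pose m := Num.max `|x.1| `|x.2|.
have m0 : 0 < m.
  rewrite /m lt_max !normr_gt0 -negb_and; apply: contra x0 => /andP[/eqP a /eqP b].
  by rewrite [x]surjective_pairing a b.
exists (m / 16); first by rewrite divr_gt0 ?ltr0n.
move=> y z /ballP2[y1 y2] /ballP2[z1 z2].
have tri (a b c : R) : `|a - b| < m / 16 -> `|a - c| < m / 16 -> `|b - c| < m / 2 / 4.
  by move=> ab ac; have := ler_distD a b c; rewrite (distrC b a); lra.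
have far (a b : R) : `|a - b| < m / 16 -> `|a| = m -> m / 2 <= `|b|.
  by move=> ab am; have := ler_normB (a - b) (- b); rewrite normrN opprK subrK am; lra.
apply: (@dot_pos y z (m / 2)); [by rewrite divr_gt0| |exact: tri y1 z1|exact: tri y2 z2].
have [ltm|lem] := ltP `|x.1| `|x.2|.
  by right; apply: far y2 _; rewrite /m (max_idPr (ltW ltm)).
by left; apply: far y1 _; rewrite /m (max_idPl lem).
Qed.

End Plane.

(** * Continuous angles of nonvanishing maps *)

Section Lift.
Variable R : realType.
Local Notation pt := (R * R)%type.

(** The angle is accumulated along the segment from the origin, cut into equal steps so short that
    consecutive values of [G] have positive inner product. All segments start at the origin, hence
    with the same angle, and the sum of the finitely many [ang] terms is continuous in the
    endpoint. *)
Lemma lift2 (G : pt -> pt) : continuous G -> (forall x, G x = G (clamp2 x)) ->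
  (forall x, G x != 0) ->
  exists2 th : pt -> R, continuous th & forall x, is_arg (G x) (th x).
Proof.
move=> Gc Gcl G0.
have [d d0 dP] : exists2 d : R, 0 < d & forall x : pt, (`[0, 1] `*` `[0, 1]) x ->
    (forall y, ball x d y -> 0 < dot (G x) (G y)).
  apply: (@compact_uniform R (R * R)%type _
    (fun d (x : pt) => forall y, ball x d y -> 0 < dot (G x) (G y))).
    by apply: compact_setX; apply: segment_compact.
  move=> x _; have [e e0 eP] := dot_near (G0 x).
  have [d1 d10 d1P] := (cont_eps G).1 Gc x e e0.
  exists (d1 / 2); first by rewrite divr_gt0.
  move=> y d xy /andP[d0 dd] z yz; apply: eP; apply: d1P.
    by apply: le_ball xy; lra.
  by rewrite (splitr d1); apply: ball_triangle xy _; apply: le_ball yz; lra.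
have [N] := ltr_add_invr d0; rewrite add0r => Nd.
pose p (i : nat) (x : pt) : pt :=
  (i%:R / N.+1%:R * clamp x.1, i%:R / N.+1%:R * clamp x.2).
have pc i : continuous (p i).
  apply: cont_pair => x; apply: cvgM; try exact: cvg_cst.
    by apply: (cont_comp (@clamp_cont R)); apply: cont_fst => ?; apply: cvg_id.
  by apply: (cont_comp (@clamp_cont R)); apply: cont_snd => ?; apply: cvg_id.
have step i x : (i < N.+1)%N -> 0 < dot (G (p i x)) (G (p i.+1 x)).
  move=> iN; have N0 : 0 < N.+1%:R :> R by rewrite ltr0n.
  have /andP[i0 i1] : (0 <= i%:R / N.+1%:R :> R) && (i%:R / N.+1%:R <= 1 :> R).
    rewrite divr_ge0 ?ler0n //= ler_pdivrMr // mul1r ler_nat; exact: ltnW.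
  have V0 : 0 < N.+1%:R^-1 :> R by rewrite invr_gt0.
  have /andP[c0 c1] := clampP x.1; have /andP[c2 c3] := clampP x.2.
  apply: dP.
    have h (k c : R) : 0 <= k -> k <= 1 -> 0 <= c -> c <= 1 -> 0 <= k * c <= 1.
      by move=> *; rewrite mulr_ge0 ?mulr_ile1.
    by split; rewrite /= in_itv /=; apply: h.
  apply/ballP2; rewrite /p /= -[i.+1]addn1 natrD mulrDl mul1r.
  have key (k c : R) : 0 <= c -> c <= 1 -> `|k * c - (k + N.+1%:R^-1) * c| < d.
    move=> cc0 cc1; have -> : k * c - (k + N.+1%:R^-1) * c = - (N.+1%:R^-1 * c) by ring.
    rewrite normrN ger0_norm; last by apply: mulr_ge0 => //; exact: ltW.
    by apply: le_lt_trans Nd; rewrite ler_piMr // ltW.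
  by split; apply: key.
have [t0 t0P] : exists t0, is_arg (G (0, 0)) t0 by apply: arg_exists.
pose th n x := t0 + \sum_(i < n) ang (G (p i x)) (G (p i.+1 x)).
have thP n x : (n <= N.+1)%N -> is_arg (G (p n x)) (th n x).
  elim: n => [_|n IH nN].
    by rewrite /th big_ord0 addr0 /p !mul0r.
  by rewrite /th big_ord_recr /= addrA; apply: arg_ang (step _ _ nN); exact/IH/ltnW.
exists (th N.+1).
  suff thc n : (n <= N.+1)%N -> continuous (th n) by exact: thc.
  elim: n => [_|n IH nN] x.
    rewrite (_ : th 0%N = fun=> t0); first exact: cvg_cst.
    by apply/funext => y; rewrite /th big_ord0 addr0.
  rewrite (_ : th n.+1 = fun y => th n y + ang (G (p n y)) (G (p n.+1 y))).
    apply: cvgD; first exact: (IH (ltnW nN)).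
    by apply: ang_cont; [apply: cont_comp|apply: cont_comp|apply: step].
  by apply/funext => y; rewrite /th big_ord_recr /= addrA.
move=> x; have := thP N.+1 x (leqnn _).
by rewrite /p divff ?mul1r -?Gcl // pnatr_eq0.
Qed.

(** The two angles differ by a multiple of [pi] at every time, hence by a constant. The sign is left
    free because a chord will be read from either of its ends. *)
Lemma arg_path_unique (u w : R -> pt) (s t : R -> R) (a b : R) : a <= b ->
  {within `[a, b], continuous s} -> {within `[a, b], continuous t} ->
  (forall r, a <= r <= b -> is_arg (u r) (s r)) ->
  (forall r, a <= r <= b -> is_arg (w r) (t r)) ->
  (forall r, a <= r <= b -> w r = u r \/ w r = - u r) ->
  s b - s a = t b - t a.
Proof.
move=> ab sc tc us wt uw.
suff : s a - t a = s b - t b by move=> E; lra.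
apply: (@sin0_constant _ (fun r => s r - t r)) => // r.
  by apply: cvgB; [apply: sc|apply: tc].
rewrite in_itv /= => rab; exact: arg_sin0 (us _ rab) (wt _ rab) (uw _ rab).
Qed.

Lemma lift1 (u : R -> pt) : continuous u -> (forall t, u t = u (clamp t)) ->
  (forall t, u t != 0) ->
  exists2 th : R -> R, continuous th & forall t, is_arg (u t) (th t).
Proof.
move=> uc ucl u0.
have [||//|th thc thP] := @lift2 (fun x => u x.1).
- by apply: cont_comp uc _; apply: cont_fst => ?; apply: cvg_id.
- by move=> x; rewrite ucl.
exists (fun t => th (t, 0)); last by move=> t; have := thP (t, 0).
by apply: cont_comp thc _; apply: cont_pair => ?; [apply: cvg_id|apply: cvg_cst].
Qed.

End Lift.

(** * Angular increments on a grid *)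

Section DiscreteStokes.
Variable R : realType.
Local Notation pt := (R * R)%type.

(** With [h] and [v] the increments along horizontal and vertical edges, the hypothesis is
    closedness on every cell; inner edges cancel. *)
Lemma grid_stokes (h v : nat -> nat -> R) n :
  (forall i j, (i < n)%N -> (j < n)%N -> h i j + v i.+1 j = v i j + h i j.+1) ->
  \sum_(i < n) h i 0%N + \sum_(j < n) v n j =
  \sum_(j < n) v 0%N j + \sum_(i < n) h i n.
Proof.
move=> cell.
have row j k : (j < n)%N -> (k <= n)%N ->
    \sum_(i < k) h i j + v k j = v 0%N j + \sum_(i < k) h i j.+1.
  move=> jn; elim: k => [_|k IH kn]; first by rewrite !big_ord0 add0r addr0.
  by have := IH (ltnW kn); have := cell k j kn jn; rewrite !big_ord_recr /=; lra.
have col k : (k <= n)%N -> \sum_(i < n) h i 0%N + \sum_(j < k) v n j =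
    \sum_(j < k) v 0%N j + \sum_(i < n) h i k.
  elim: k => [_|k IH kn]; first by rewrite !big_ord0 add0r addr0.
  by have := IH (ltnW kn); have := row k n kn (leqnn n); rewrite !big_ord_recr /=; lra.
exact: col.
Qed.

Section Sides.
Variables (M : R) (M0 : 0 < M).

Let side_arg (k : pt) (t x : R) (y : pt) : is_arg k t -> dot k y = M ->
  cross k y = x -> is_arg y (t + atan (x / M)).
Proof. by move=> kt d c; rewrite -c -d; apply: arg_ang; rewrite // d. Qed.

Lemma arg_right y : is_arg (M, y) (atan (y / M)).
Proof.
rewrite -[atan _]add0r; apply: (@side_arg (1, 0)); rewrite /is_arg /dot /cross /=.
- by rewrite sin0 cos0; split; lra.
- ring.
- ring.
Qed.
Lemma arg_left y : is_arg (- M, y) (pi - atan (y / M)).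
Proof.
rewrite -atanN -mulNr; apply: (@side_arg (-1, 0)); rewrite /is_arg /dot /cross /=.
- by rewrite sinpi cospi; split; lra.
- ring.
- ring.
Qed.
Lemma arg_top x : is_arg (x, M) (pi / 2 - atan (x / M)).
Proof.
rewrite -atanN -mulNr; apply: (@side_arg (0, 1)); rewrite /is_arg /dot /cross /=.
- by rewrite sin_pihalf cos_pihalf; split; lra.
- ring.
- ring.
Qed.
Lemma arg_bottom x : is_arg (x, - M) (- (pi / 2) + atan (x / M)).
Proof.
apply: (@side_arg (0, -1)); rewrite /is_arg /dot /cross /=.
- by rewrite sinN cosN sin_pihalf cos_pihalf; split; lra.
- ring.
- ring.
Qed.
End Sides.

Variables (p : pt) (W Z : set pt) (B : pt -> pt -> R) (eps d M : R).
Hypotheses (eps0 : 0 < eps) (d0 : 0 < d) (M0 : 0 < M).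
Hypothesis Wfar : forall z, M <= `|z.1 - p.1| \/ M <= `|z.2 - p.2| -> W z.
Hypothesis away : forall z, W z \/ Z z -> eps <= `|z.1 - p.1| \/ eps <= `|z.2 - p.2|.
Hypothesis ZW : forall z, Z z -> ~ W z.
Hypothesis WZ : forall x y, W x -> ~ W y -> exists2 c, Z c &
  forall q r, ball q r x -> ball q r y -> ball q r c.
Hypothesis Badd : forall q x y z, ~ W x -> ~ W y -> ~ W z ->
  ball q d x -> ball q d y -> ball q d z -> B x y + B y z = B x z.
Hypothesis Bang : forall q x y, Z x -> Z y -> ball q d x -> ball q d y ->
  B x y = ang (x - p) (y - p).

(* Summing the increments of [ang] and [B] over a fine grid: each cell
   contributes 0, whereas the boundary of a large square, which lies in [W],
   contributes 2 pi. *)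
Lemma no_angular_cocycle : False.
Proof.
pose r := Num.min d (eps / 8).
have r0 : 0 < r by rewrite /r lt_min d0 divr_gt0.
have rd (q x : pt) : ball q r x -> ball q d x.
  by apply: le_ball; rewrite /r ge_min lexx.
have re (q x y : pt) : ball q r x -> ball q r y -> W x \/ Z x ->
    0 < dot (x - p) (y - p).
  move=> /ballP2[x1 x2] /ballP2[y1 y2] /away xe.
  have re : r <= eps / 8 by rewrite /r ge_min lexx orbT.
  have tri (a b c : R) : `|a - b| < r -> `|a - c| < r -> `|b - c| < eps / 4.
    by move=> ab ac; have := ler_distD a b c; rewrite (distrC b a); lra.
  apply: (@dot_pos R (x - p) (y - p) eps eps0 xe) => /=.
    by rewrite (_ : _ - _ = x.1 - y.1); [exact: tri x1 y1|ring].
  by rewrite (_ : _ - _ = x.2 - y.2); [exact: tri x2 y2|ring].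
pose an x y := ang (x - p) (y - p).
have an_add q x y z : ball q r x -> ball q r y -> ball q r z ->
    W x \/ Z x -> W y \/ Z y -> W z \/ Z z -> an x y + an y z = an x z.
  by move=> qx qy qz hx hy hz; apply: ang_add; apply: re; eauto.
have [c cP] : exists c : pt -> pt -> pt, forall x y, W x -> ~ W y ->
    Z (c x y) /\ forall q r, ball q r x -> ball q r y -> ball q r (c x y).
  have H (xy : pt * pt) : exists z, W xy.1 -> ~ W xy.2 ->
      Z z /\ forall q r, ball q r xy.1 -> ball q r xy.2 -> ball q r z.
    case: (pselect (W xy.1)) => [w1|w1]; last by exists xy.1.
    case: (pselect (W xy.2)) => [w2|w2]; first by exists xy.1.
    by have [z Zz zP] := WZ w1 w2; exists z.
  by have [f fP] := choice H; exists (fun x y => f (x, y)) => x y; apply: (fP (x, y)).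
(* Here [W] plays the exterior and [Z] a part of the curve: the increment is the true angle inside
   [W], [B] outside it, and a mixed edge is broken at a crossing point in [Z]. *)
pose a x y := if `[< W x >] then
    if `[< W y >] then an x y else an x (c x y) + B (c x y) y
  else if `[< W y >] then B x (c y x) + an (c y x) y else B x y.
have Bxx q x : ~ W x -> ball q r x -> B x x = 0.
  by move=> Wx /rd qx; have := Badd Wx Wx Wx qx qx qx; lra.
(* On a small ball the increment has a potential. If the ball meets both [W] and its complement, the
   potential is measured from one crossing point [c0]; other crossing points are compared with it
   through [Bang]. *)
have cell q : exists b : pt -> R, forall x y, ball q r x -> ball q r y ->
    a x y = b y - b x.
  have [[x0 [y0 [Wx0 Wy0 qx0 qy0]]]|nomix] :=
      pselect (exists x y, [/\ W x, ~ W y, ball q r x & ball q r y]).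
    have [Zc /(_ q r qx0 qy0) qc] := cP _ _ Wx0 Wy0.
    set c0 := c x0 y0 in Zc qc.
    exists (fun z => if `[< W z >] then an c0 z else B c0 z) => x y qx qy.
    rewrite /a; case: asboolP => Wx; case: asboolP => Wy.
    - have := @an_add q c0 x y qc qx qy; rewrite /=.
      by move=> H; have := H (or_intror Zc) (or_introl Wx) (or_introl Wy); lra.
    - have [Zc' /(_ q r qx qy) qc'] := cP _ _ Wx Wy; set c1 := c x y in Zc' qc' *.
      have := an_add q c0 x c1 qc qx qc' (or_intror Zc) (or_introl Wx) (or_intror Zc').
      have := Bang Zc Zc' (rd _ _ qc) (rd _ _ qc'); rewrite -/(an c0 c1).
      have := Badd (ZW Zc) (ZW Zc') Wy (rd _ _ qc) (rd _ _ qc') (rd _ _ qy).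
      lra.
    - have [Zc' /(_ q r qy qx) qc'] := cP _ _ Wy Wx; set c1 := c y x in Zc' qc' *.
      have := an_add q c0 c1 y qc qc' qy (or_intror Zc) (or_intror Zc') (or_introl Wy).
      have := Bang Zc Zc' (rd _ _ qc) (rd _ _ qc'); rewrite -/(an c0 c1).
      have := Badd (ZW Zc) Wx (ZW Zc') (rd _ _ qc) (rd _ _ qx) (rd _ _ qc').
      lra.
    - by have := Badd (ZW Zc) Wx Wy (rd _ _ qc) (rd _ _ qx) (rd _ _ qy); lra.
  have qq : ball q r q by apply: ballxx.
  have nm x y : ball q r x -> ball q r y -> W x -> W y.
    by move=> qx qy Wx; apply: contrapT => Wy; apply: nomix; exists x, y.
  exists (a q) => x y qx qy; rewrite /a.
  have [Wq|Wq] := pselect (W q).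
    rewrite !asboolT //; [|exact: nm qq _ Wq ..].
    have := an_add q q x y qq qx qy (or_introl Wq).
    by move=> /(_ (or_introl (nm _ _ qq qx Wq)) (or_introl (nm _ _ qq qy Wq))); lra.
  have Wx : ~ W x by move=> /(nm _ _ qx qq).
  have Wy : ~ W y by move=> /(nm _ _ qy qq).
  by rewrite !asboolF //; have := Badd Wq Wx Wy (rd _ _ qq) (rd _ _ qx) (rd _ _ qy); lra.
have [N] := ltr_add_invr (divr_gt0 r0 (mulr_gt0 (ltr0Sn R 1) M0)).
rewrite add0r => Nr; set n := N.+1 in Nr.
have n0 : (n%:R : R) != 0 by rewrite pnatr_eq0.
pose s (i : nat) : R := - M + 2 * M * (i%:R / n%:R).
have s0 : s 0%N = - M by rewrite /s mul0r mulr0 addr0.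
have sn : s n = M by rewrite /s divff // mulr1; ring.
have sS i : `|s i - s i.+1| < r.
  have -> : s i - s i.+1 = - (2 * M * n%:R^-1).
    by rewrite /s -[i.+1]addn1 natrD; field.
  rewrite normrN ger0_norm; last by rewrite mulr_ge0 ?mulr_ge0 ?invr_ge0 ?ler0n ?ltW.
  by rewrite mulrC -ltr_pdivlMr ?mulr_gt0 ?ltr0n.
pose z i j : pt := (p.1 + s i, p.2 + s j).
pose h i j := a (z i j) (z i.+1 j); pose v i j := a (z i j) (z i j.+1).
have grid i j : (i < n)%N -> (j < n)%N -> h i j + v i.+1 j = v i j + h i j.+1.
  move=> _ _; have [b bP] := cell (z i j).
  have near i' j' : i' = i \/ i' = i.+1 -> j' = j \/ j' = j.+1 ->
      ball (z i j) r (z i' j').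
    move=> hi hj; apply/ballP2; rewrite /z /=; split.
      rewrite (_ : _ - _ = s i - s i'); last by ring.
      by case: hi => ->; rewrite ?subrr ?normr0.
    rewrite (_ : _ - _ = s j - s j'); last by ring.
    by case: hj => ->; rewrite ?subrr ?normr0.
  by rewrite /h /v !bP; [ring|apply: near; auto ..].
have Wz z' : `|z'.1 - p.1| = M \/ `|z'.2 - p.2| = M -> W z'.
  by case=> E; apply: Wfar; rewrite E lexx; auto.
have aW x y : W x -> W y -> a x y = an x y by move=> Wx Wy; rewrite /a !asboolT.
have atb (x : R) : - (pi / 2) < atan x < pi / 2 by rewrite atan_gtNpi2 atan_ltpi2.
have an_side x y t t' : W x -> ball x r y -> is_arg (x - p) t -> is_arg (y - p) t' ->
   `|t' - t| < pi -> an x y = t' - t.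
  move=> Wx xy xt yt tt; rewrite /an (arg_diff_ang xt yt) //.
    by apply: re xy _; [apply: ballxx|left].
  by apply: lt_trans tt _; have := pi_gt0 R; lra.
pose T i := atan (s i / M).
have TT i j : `|T i - T j| < pi.
  have /andP[? ?] := atb (s i / M); have /andP[? ?] := atb (s j / M).
  by rewrite /T ltr_norml; apply/andP; split; lra.
have zE i j : z i j - p = (s i, s j).
  by rewrite /z; case: (p) => p1 p2 /=; congr pair; rewrite /=; ring.
have nMz : `|- M| = M by rewrite normrN gtr0_norm.
have pMz : `|M| = M by rewrite gtr0_norm.
have zW i j : `|s i| = M \/ `|s j| = M -> W (z i j).
  by move=> E; apply: Wz; have := zE i j; case=> -> ->.
have hb i j : ball (z i j) r (z i.+1 j).
  apply/ballP2; rewrite /z /= subrr normr0; split => //.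
  by rewrite (_ : _ - _ = s i - s i.+1) //; ring.
have vb i j : ball (z i j) r (z i j.+1).
  apply/ballP2; rewrite /z /= subrr normr0; split => //.
  by rewrite (_ : _ - _ = s j - s j.+1) //; ring.
(* On each side of the square [T] runs from [- pi / 4] to [pi / 4], a quarter turn. *)
have tele : \sum_(i < n) (T i.+1 - T i) = pi / 2.
  rewrite -(big_mkord xpredT (fun i => T i.+1 - T i)) telescope_sumr //.
  rewrite /T s0 sn mulNr atanN divff ?gt_eqF // atan1.
  by lra.
have H1 i : h i 0%N = T i.+1 - T i.
  rewrite /h aW; [|by apply: zW; rewrite s0; auto ..].
  rewrite (@an_side _ _ (- (pi / 2) + T i) (- (pi / 2) + T i.+1)) //.
  - by ring.
  - by apply: zW; rewrite s0; auto.
  - by rewrite zE s0; apply: arg_bottom.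
  - by rewrite zE s0; apply: arg_bottom.
  - by rewrite (_ : _ - _ = T i.+1 - T i) ?TT //; ring.
have H2 i : h i n = - (T i.+1 - T i).
  rewrite /h aW; [|by apply: zW; rewrite sn; auto ..].
  rewrite (@an_side _ _ (pi / 2 - T i) (pi / 2 - T i.+1)) //.
  - by ring.
  - by apply: zW; rewrite sn; auto.
  - by rewrite zE sn; apply: arg_top.
  - by rewrite zE sn; apply: arg_top.
  - by rewrite (_ : _ - _ = T i - T i.+1) ?TT //; ring.
have V1 j : v n j = T j.+1 - T j.
  rewrite /v aW; [|by apply: zW; rewrite sn; auto ..].
  rewrite (@an_side _ _ (T j) (T j.+1)) //.
  - by apply: zW; rewrite sn; auto.
  - by rewrite zE sn; apply: arg_right.
  - by rewrite zE sn; apply: arg_right.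
have V2 j : v 0%N j = - (T j.+1 - T j).
  rewrite /v aW; [|by apply: zW; rewrite s0; auto ..].
  rewrite (@an_side _ _ (pi - T j) (pi - T j.+1)) //.
  - by ring.
  - by apply: zW; rewrite s0; auto.
  - by rewrite zE s0; apply: arg_left.
  - by rewrite zE s0; apply: arg_left.
  - by rewrite (_ : _ - _ = T j - T j.+1) ?TT //; ring.
have := grid_stokes grid.
rewrite (eq_bigr _ (fun (i : 'I_n) _ => H1 i)) (eq_bigr _ (fun (i : 'I_n) _ => V1 i)).
rewrite (eq_bigr _ (fun (i : 'I_n) _ => V2 i)) (eq_bigr _ (fun (i : 'I_n) _ => H2 i)).
by rewrite !sumrN tele; have := pi_gt0 R; lra.
Qed.

End DiscreteStokes.

(** * Simple closed curves and the crossing lemma *)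

Section Paths.
Variable R : realType.
Local Notation pt := (R * R)%type.

(** The path is continuous and stays in [X] on the whole line, so that no subspace topology is
    carried along; constructions clamp the time where necessary. *)
Definition pathin (X : set pt) (x y : pt) := exists f : R -> pt,
  [/\ continuous f, f 0 = x, f 1 = y & forall t, X (f t)].

Lemma pathin_sub (X Y : set pt) x y : X `<=` Y -> pathin X x y -> pathin Y x y.
Proof. by move=> XY [f [fc f0 f1 fX]]; exists f; split=> // t; apply: XY. Qed.

Lemma pathin_refl (X : set pt) x : X x -> pathin X x x.
Proof. by move=> Xx; exists (fun=> x); split=> // t; apply: cvg_cst. Qed.

Lemma pathin_in (X : set pt) x y : pathin X x y -> X x /\ X y.
Proof. by move=> [f [_ <- <- fX]]. Qed.

Lemma pathin_sym (X : set pt) x y : pathin X x y -> pathin X y x.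
Proof.
move=> [f [fc f0 f1 fX]]; exists (fun t => f (1 - t)); split=> //.
- apply: cont_comp fc _ => t; apply: cvgB; [apply: cvg_cst|apply: cvg_id].
- by rewrite subr0.
- by rewrite subrr.
Qed.

Lemma pathin_trans (X : set pt) x y z : pathin X x y -> pathin X y z -> pathin X x z.
Proof.
move=> [f [fc f0 f1 fX]] [g [gc g0 g1 gX]].
(* At every time one of the two summands equals [y], which is subtracted. *)
exists (fun t => f (clamp (2 * t)) + g (clamp (2 * t - 1)) - y).
have tw : continuous (fun t : R => 2 * t) by move=> t; apply: cvgM; [apply: cvg_cst|apply: cvg_id].
have tw1 : continuous (fun t : R => 2 * t - 1).
  by move=> t; apply: cvgB; [apply: tw|apply: cvg_cst].
have low t : t <= 1 / 2 -> clamp (2 * t - 1) = 0.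
  by move=> t2; rewrite /clamp (min_idPr _) ?(max_idPl _) //; lra.
have high t : 1 / 2 <= t -> clamp (2 * t) = 1.
  by move=> t2; rewrite /clamp (min_idPl _) ?(max_idPr _) //; lra.
split.
- move=> t; apply: cvgB; last exact: cvg_cst.
  apply: cvgD; first exact: (cont_comp fc (cont_comp (@clamp_cont R) tw)).
  exact: (cont_comp gc (cont_comp (@clamp_cont R) tw1)).
- rewrite low; last by lra.
  by rewrite mulr0 clamp0 f0 g0 addrK.
- rewrite high; last by lra.
  by rewrite f1 (_ : 2 * 1 - 1 = 1) ?clamp1 ?g1 1?addrC ?addKr //; lra.
move=> t; have [t2|/ltW t2] := leP t (1 / 2).
  by rewrite low // g0 addrK.
by rewrite high // f1 addrC addKr.
Qed.

Lemma pathin_image (f : R -> pt) (a b : R) : a <= b ->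
  {within `[a, b], continuous f} ->
  forall s t, a <= s <= b -> a <= t <= b -> pathin (f @` `[a, b]) (f s) (f t).
Proof.
move=> ab fc s t sab tab.
pose h r := s + (t - s) * clamp r.
have hab r : a <= h r <= b.
  have /andP[c0 c1] := clampP r; move: sab tab => /andP[? ?] /andP[? ?].
  by rewrite /h; apply/andP; split; nra.
exists (f \o h); split.
- apply: within_cont fc _ _ => [r|r]; last by rewrite /= in_itv /= hab.
  apply: cvgD; first exact: cvg_cst.
  by apply: cvgM; [apply: cvg_cst|apply: clamp_cont].
- by rewrite /= /h clamp0 mulr0 addr0.
- by rewrite /= /h clamp1 mulr1 addrC subrK.
- by move=> r; exists (h r) => //; rewrite /= in_itv /= hab.
Qed.

Definition seg (x y : pt) (t : R) : pt :=
  (x.1 + t * (y.1 - x.1), x.2 + t * (y.2 - x.2)).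

Lemma seg0 x y : seg x y 0 = x.
Proof. by rewrite /seg !mul0r !addr0 -surjective_pairing. Qed.
Lemma seg1 x y : seg x y 1 = y.
Proof. by rewrite /seg !mul1r !(addrC _ (_ - _)) !subrK -surjective_pairing. Qed.

Lemma seg_cont x y : continuous (seg x y).
Proof.
apply: cont_pair => t; (apply: cvgD; [exact: cvg_cst|apply: cvgM; [exact: cvg_id|exact: cvg_cst]]).
Qed.

Lemma seg_ball x y t (q : pt) r : 0 <= t <= 1 -> ball q r x -> ball q r y ->
  ball q r (seg x y t).
Proof.
move=> /andP[t0 t1] /ballP2[x1 x2] /ballP2[y1 y2]; apply/ballP2.
have aux (a b c : R) : `|a - b| < r -> `|a - c| < r -> `|a - (b + t * (c - b))| < r.
  move=> h1 h2; have [m [m1 m2 m3]] : exists m, [/\ `|a - b| <= m, `|a - c| <= m & m < r].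
    by exists (Num.max `|a - b| `|a - c|); rewrite !le_max !lexx orbT gt_max h1 h2.
  apply: le_lt_trans m3; have -> : a - (b + t * (c - b)) = (1 - t) * (a - b) + t * (a - c) by ring.
  apply: le_trans (ler_normD _ _) _; rewrite !normrM (ger0_norm t0) ger0_norm ?subr_ge0 //.
  by have -> : m = (1 - t) * m + t * m by [ring]; apply: lerD; apply: ler_wpM2l; rewrite ?subr_ge0.
by split; apply: aux.
Qed.

Lemma pathin_seg (X : set pt) x y :
  (forall t, 0 <= t <= 1 -> X (seg x y t)) -> pathin X x y.
Proof.
move=> h; have := @pathin_image (seg x y) 0 1 ler01 (@cont_within _ _ _ _ (@seg_cont x y)).
move=> /(_ 0 1); rewrite seg0 seg1 lexx ler01 lexx => /(_ isT isT).
by apply: pathin_sub => _ [t + <-]; rewrite /= in_itv /= => /h.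
Qed.

(** The hypothesis makes [P] closed in [[0, 1]], so the infimum is attained. Where a hit is not
    guaranteed, the lemma is applied to the disjunction of [P] with being at time 1. *)
Lemma first_hit (P : R -> Prop) : P 1 ->
  (forall t, 0 <= t <= 1 -> ~ P t -> exists2 e, 0 < e &
     forall s, 0 <= s <= 1 -> `|t - s| < e -> ~ P s) ->
  exists t, [/\ 0 <= t <= 1, P t & forall s, 0 <= s < t -> ~ P s].
Proof.
move=> P1 cl; pose S := [set t | 0 <= t <= 1 /\ P t].
have S1 : S 1 by split; rewrite ?lexx ?ler01.
have lbS : lbound S 0 by move=> t [/andP[]].
have iS : has_inf S by split; [exists 1|exists 0].
have t0 : 0 <= inf S by apply: lb_le_inf => //; exists 1.
have t1 : inf S <= 1 by apply: ge_inf => //; exists 0.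
have low s : 0 <= s < inf S -> ~ P s.
  move=> /andP[s0 sS] Ps; have : inf S <= s.
    by apply: ge_inf; [exists 0|split=> //; rewrite s0 /= (le_trans (ltW sS))].
  by rewrite leNgt sS.
exists (inf S); split; rewrite ?t0 ?t1 //.
apply: contrapT => nP; have [|e e0 eP] := cl _ _ nP; first by rewrite t0.
have : inf S + e <= inf S; last by rewrite gerDl leNgt e0.
apply: lb_le_inf; first by exists 1.
move=> t [t01 Pt]; rewrite leNgt; apply/negP => te.
apply: (eP t t01 _ Pt); rewrite distrC ger0_norm ?subr_ge0; last first.
  by have := ge_inf iS.2 (conj t01 Pt).
by rewrite ltrBlDl.
Qed.

End Paths.

(** * Exterior and short arcs of a simple closed curve *)

Section ClosedCurve.
Variable R : realType.
Local Notation pt := (R * R)%type.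
Variable C : R -> pt.
Hypothesis HC : simple_closed_curve C.

(** The complement of this set serves as the closed region: it contains [C] and the closure of the
    interior. *)
Definition exterior : set pt := [set z | ~ trace C z /\
  ~ bounded_set (connected_component (~` trace C) z)].
Local Notation U := exterior.

Let Cc : {within `[0, 1], continuous C} := HC.1.
Let C01 : C 0 = C 1 := HC.2.1.

Lemma traceP z : trace C z -> exists2 t, 0 <= t < 1 & C t = z.
Proof.
move=> [t]; rewrite /= in_itv /= => /andP[t0 t1] Ct.
have [t1'|t1'] := ltP t 1; first by exists t; rewrite ?t0.
exists 0; rewrite ?lexx ?ltr01 // C01 -Ct; congr C.
by apply/eqP; rewrite eq_le t1 t1'.
Qed.

Lemma trace_in t : 0 <= t <= 1 -> trace C (C t).
Proof. by move=> t01; exists t; rewrite //= in_itv /= t01. Qed.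

Lemma curve_compact (g : R -> pt) : curve g -> compact (trace g).
Proof. by move=> gc; apply: continuous_compact gc _; apply: segment_compact. Qed.

Lemma compact_ball_free (A : set pt) z : compact A -> ~ A z ->
  exists2 e, 0 < e & forall y, ball z e y -> ~ A y.
Proof.
move=> cA nA; have clA : closed A.
  by apply: compact_closed cA; exact: norm_hausdorff.
have /nbhs_ballP[e /= e0 eP] : nbhs z (~` A).
  by apply: open_nbhs_nbhs; split=> //; apply: closed_openC.
by exists e.
Qed.

Lemma pathin_component (X : set pt) x y : pathin X x y ->
  connected_component X x = connected_component X y.
Proof.
move=> [f [fc f0 f1 fX]]; apply: same_connected_component.
exists (f @` `[0, 1]); last by exists 1; rewrite //= in_itv /= lexx ler01.
split.
- by exists 0; rewrite //= in_itv /= lexx ler01.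
- by move=> _ [t _ <-].
- apply: connected_continuous_connected; first exact: segment_connected.
  exact: cont_within.
Qed.

Lemma exterior_path x y : pathin (~` trace C) x y -> U x -> U y.
Proof.
by move=> xy [Cx bx]; split; [case: (pathin_in xy)|rewrite -(pathin_component xy)].
Qed.

Lemma interior_path x y : pathin (~` trace C) x y ->
  curve_interior C x -> curve_interior C y.
Proof.
by move=> xy [Cx bx]; split; [case: (pathin_in xy)|rewrite -(pathin_component xy)].
Qed.

Lemma off_trace_ball z : ~ trace C z -> exists2 e, 0 < e &
  forall y, ball z e y -> pathin (~` trace C) z y.
Proof.
move=> /(compact_ball_free (curve_compact Cc))[e e0 eP]; exists e => // y zy.
apply: pathin_seg => t t01; apply: eP; apply: seg_ball => //.
exact: ballxx.
Qed.

Lemma exterior_ball z : U z -> exists2 e, 0 < e & ball z e `<=` U.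
Proof.
move=> Uz; have [e e0 eP] := off_trace_ball Uz.1.
by exists e => // y /eP /exterior_path; apply.
Qed.

Lemma interior_ball z : curve_interior C z -> exists2 e, 0 < e &
  forall y, ball z e y -> ~ U y /\ ~ trace C y.
Proof.
move=> Iz; have [e e0 eP] := off_trace_ball Iz.1; exists e => // y /eP zy.
by have [Cy by_] := interior_path zy Iz; split=> // -[_]; apply.
Qed.

Lemma closure_interior_sub : closure (curve_interior C) `<=` ~` U.
Proof.
move=> z cz Uz; have [e e0 eU] := exterior_ball Uz.
have [y [[Cy by_] /eU[_]]] : (curve_interior C `&` ball z e) !=set0.
  by apply: cz; apply: nbhsx_ballx.
by apply.
Qed.

Lemma trace_sub : trace C `<=` ~` U.
Proof. by move=> z Cz []. Qed.

Lemma trace_bounded : exists2 M, 0 < M &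
  forall z, trace C z -> `|z.1| < M /\ `|z.2| < M.
Proof.
have [M M0 MP] : exists2 M, 0 < M & forall z, trace C z -> `|z| <= M.
  have /compact_bounded[M [Mr MP]] := curve_compact Cc.
  exists (Num.max 1 (M + 1)); first by rewrite lt_max ltr01.
  by apply: MP; rewrite lt_max; apply/orP; right; rewrite ltrDl.
exists (M + 1); first by apply: addr_gt0.
move=> z /MP; rewrite prod_normE /= ge_max => /andP[? ?]; split; lra.
Qed.

(** Moving outward in both coordinates only increases their absolute values, so the ray from [z]
    avoids the trace and makes the component of [z] unbounded. *)
Lemma far_exterior (M : R) z : 0 < M ->
  (forall y, trace C y -> `|y.1| < M /\ `|y.2| < M) ->
  M <= `|z.1| \/ M <= `|z.2| -> U z.
Proof.
move=> M0 MP zM.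
pose dir (r : R) : R := if 0 <= r then 1 else -1.
have dirP (r k : R) : 0 <= k -> `|r + k * dir r| = `|r| + k.
  move=> k0; rewrite /dir; case: (leP 0 r) => r0.
    by rewrite mulr1 !ger0_norm ?addr_ge0.
  by rewrite mulrN1 !ltr0_norm ?opprB 1?addrC ?subr_lt0 ?(lt_le_trans r0) //; lra.
pose q (k : R) : pt := (z.1 + k * dir z.1, z.2 + k * dir z.2).
have qoff k : 0 <= k -> ~ trace C (q k).
  by move=> k0 /MP[]; rewrite /q /= !dirP //; case: zM => *; lra.
have q0 : q 0 = z by rewrite /q !mul0r !addr0 -surjective_pairing.
split; first by rewrite -q0; apply: qoff.
move=> [B [Br BP]].
pose k : R := `|B| + 1; have k0 : 0 <= k by rewrite addr_ge0.
have zq : pathin (~` trace C) z (q k).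
  apply: pathin_seg => t /andP[t0 t1].
  rewrite (_ : seg _ _ _ = q (t * k)); first by apply: qoff; apply: mulr_ge0.
  by rewrite /seg /q /=; congr pair; ring.
have : connected_component (~` trace C) z (q k).
  rewrite (pathin_component zq); apply: connected_component_refl.
  by have [] := pathin_in zq.
have lB : B < `|B| + 1 / 2 by have := ler_norm B; lra.
move=> /(BP _ lB); rewrite /= prod_normE /= ge_max /q /= !dirP // => /andP[le1 _].
have {}le1 : `|z.1| + k <= `|B| + 1 / 2 := le1.
by have := normr_ge0 z.1; rewrite /k in le1; lra.
Qed.

(** A point off the trace has a ball within a single component, so the first exit from the exterior
    takes place on the trace. *)
Lemma cross_trace x y : U x -> ~ U y -> exists t,
  [/\ 0 <= t <= 1, trace C (seg x y t) & forall s, 0 <= s < t -> U (seg x y s)].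
Proof.
move=> Ux Uy; have [|t _ /contrapT Ut|t [t01 Ut tmin]] := @first_hit R (fun t => ~ U (seg x y t)).
- by rewrite seg1.
- have [e e0 eU] := exterior_ball Ut.
  have [d d0 dP] := (cont_eps _).1 (@seg_cont _ x y) t e e0.
  by exists d => // s _ ts; apply; apply/eU/dP/ballR.
exists t; split=> // [|s /tmin/contrapT//].
apply: contrapT => nC; have [e e0 eP] := off_trace_ball nC.
have [d d0 dP] := (cont_eps _).1 (@seg_cont _ x y) t e e0.
have t0 : 0 < t.
  move: t01 => /andP[t0 _]; rewrite lt_neqAle t0 andbT.
  by apply/eqP => t00; apply: Ut; rewrite -t00 seg0.
pose s := Num.max 0 (t - d / 2).
have st : 0 <= s < t by rewrite /s le_max lexx gt_max t0 /=; lra.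
have /contrapT Us := tmin _ st; apply: Ut; apply: exterior_path Us.
have s1 : t - d / 2 <= s by rewrite /s le_max lexx orbT.
by apply/pathin_sym/eP/dP/ballR; move: st => /andP[_ st]; rewrite ger0_norm; lra.
Qed.

Lemma curve_inj s t : 0 <= s -> s < t -> t <= 1 -> t - s < 1 -> C s <> C t.
Proof.
move=> s0 st t1 ts E; have [t1'|t1'] := ltP t 1.
  have := HC.2.2 s t; rewrite !in_itv /= s0 (lt_trans st t1') t1'.
  by rewrite (le_trans s0 (ltW st)) => /(_ isT isT E) => st'; rewrite st' ltxx in st.
have tE : t = 1 by apply/eqP; rewrite eq_le t1.
have := HC.2.2 s 0; rewrite !in_itv /= s0 lexx ltr01.
have s1 : s < 1 by rewrite -tE.
rewrite s1 => /(_ isT isT); rewrite E tE C01 => /(_ erefl) s00.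
by move: ts; rewrite s00 tE subr0 ltxx.
Qed.

(* In the second alternative the short arc passes through [C 0 = C 1]. *)
Lemma short_arc (e : R) : 0 < e -> exists2 d, 0 < d &
  forall s t, 0 <= s -> s <= t -> t < 1 -> ball (C s) d (C t) ->
    (forall u, s <= u <= t -> ball (C s) e (C u)) \/
    (forall u, 0 <= u <= s \/ t <= u <= 1 -> ball (C s) e (C u)).
Proof.
move=> e0.
have Cinj := curve_inj.
pose D t := C (clamp t).
have Dc : continuous D by apply: within_cont Cc (@clamp_cont R) _ => t; exact: clamp_in.
have DE t : 0 <= t <= 1 -> D t = C t by move=> t01; rewrite /D clamp_id.
have [n n0 nP] : exists2 n, 0 < n & forall u, `[0, 1]%classic u ->
    forall v, `|u - v| < n -> ball (D u) (e / 2) (D v).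
  apply: (@compact_uniform R R _ (fun n u => forall v,
     `|u - v| < n -> ball (D u) (e / 2) (D v))); first exact: segment_compact.
  move=> u _; have [d d0 dP] := (cont_eps _).1 Dc u (e / 4) (divr_gt0 e0 (ltr0Sn _ 3)).
  exists (d / 2); first by rewrite divr_gt0.
  move=> u' d' /ballR uu' /andP[d'0 dd'] v uv.
  have h1 : ball (D u) (e / 4) (D v).
    by apply/dP/ballR; have := ler_distD u' u v; lra.
  have h2 : ball (D u) (e / 4) (D u') by apply/dP/ballR; lra.
  rewrite (_ : e / 2 = e / 4 + e / 4); last by lra.
  exact: ball_triangle (ball_sym h2) h1.
have {}nP u v : 0 <= u <= 1 -> 0 <= v <= 1 -> `|u - v| < n -> ball (C u) (e / 2) (C v).
  move=> u01 v01 uv; rewrite -(DE u) // -(DE v) //; apply: nP uv.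
  by rewrite /= in_itv.
have le2 x y : ball (C x) (e / 2) y -> ball (C x) e y by apply: le_ball; lra.
(* Parameters at least [n] apart both ways around the circle give points at distance at least [d];
   hence points closer than that have nearby parameters or parameters near opposite ends of the
   interval. *)
have [d d0 dP] : exists2 d, 0 < d & forall st : pt, (`[0, 1] `*` `[0, 1]) st ->
    (n <= st.2 - st.1 <= 1 - n -> ~ ball (D st.1) d (D st.2)).
  apply: (@compact_uniform R pt _ (fun d st =>
     n <= st.2 - st.1 <= 1 - n -> ~ ball (D st.1) d (D st.2))).
    by apply: compact_setX; apply: segment_compact.
  move=> [s t] [/= s01 t01]; rewrite !in_itv /= in s01 t01.
  have [st|nst] := pselect (n / 2 <= t - s <= 1 - n / 2); last first.
    exists (n / 4); first by rewrite divr_gt0.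
    move=> [s' t'] d /ballP2 /= [ss tt] dn /andP[h1 h2]; case: nst; move: ss tt.
    by rewrite !ltr_norml => /andP[? ?] /andP[? ?]; apply/andP; split; lra.
  have [e1 e10 e1P] : exists2 e1, 0 < e1 & ~ ball (D s) e1 (D t).
    have ne : D s <> D t.
      rewrite !DE //; move: s01 t01 st => /andP[? ?] /andP[? ?] /andP[? ?].
      by apply: Cinj; lra.
    have [e1 e10 e1P] := compact_ball_free (@compact_set1 pt (D t)) (z := D s) ne.
    by exists e1 => // /e1P; apply.
  have e13 : 0 < e1 / 3 by rewrite divr_gt0.
  have [d1 d10 d1P] := (cont_eps _).1 Dc s _ e13.
  have [d2 d20 d2P] := (cont_eps _).1 Dc t _ e13.
  exists (Num.min (e1 / 3) (Num.min d1 d2)); first by rewrite !lt_min e13 d10.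
  move=> [s' t'] d /ballP2 /= [ss tt]; rewrite !lt_min in ss tt *.
  move=> /andP[d0 /andP[de _]] _ b; apply: e1P.
  move: ss tt => /andP[_ /andP[ss _]] /andP[_ /andP[_ tt]].
  have b1 : ball (D s) (e1 / 3) (D s') by apply/d1P/ballR.
  have b2 : ball (D t) (e1 / 3) (D t') by apply/d2P/ballR.
  have b3 : ball (D s') (e1 / 3) (D t') by apply: le_ball b; exact: ltW.
  have := ball_triangle (ball_triangle b1 b3) (ball_sym b2).
  by apply: le_ball; lra.
exists d => // s t s0 st t1 b.
have [tn|tn] := ltP (t - s) n.
  left=> u /andP[su ut]; apply/le2/nP; rewrite ?s0 /=; try by [lra|apply/andP; split; lra].
  by rewrite distrC ger0_norm; lra.
have [tn1|tn1] := leP (t - s) (1 - n).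
  case: (dP (s, t)) => /=; rewrite ?tn ?tn1 // ?DE ?s0 //=; try lra; try (apply/andP; split; lra).
  by split; rewrite /= in_itv /=; apply/andP; split; lra.
right=> u [/andP[u0 us]|/andP[tu u1]].
  by apply/le2/nP; try (apply/andP; split; lra); rewrite ger0_norm; lra.
have h1 : ball (C s) (e / 2) (C 0).
  by apply: nP; try (apply/andP; split; lra); rewrite subr0 ger0_norm; lra.
have h2 : ball (C 1) (e / 2) (C u).
  by apply: nP; try (apply/andP; split; lra); rewrite ger0_norm; lra.
by rewrite (splitr e); apply: ball_triangle h1 _; rewrite C01.
Qed.
End ClosedCurve.

(** * The curve as the boundary of its exterior *)

Section Boundary.
Variable R : realType.
Local Notation pt := (R * R)%type.
Variable C : R -> pt.
Hypothesis HC : simple_closed_curve C.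
Variable p : pt.
Hypothesis Ip : curve_interior C p.
Local Notation U := (exterior C).

Let Cc : {within `[0, 1], continuous C} := HC.1.
Let C01 : C 0 = C 1 := HC.2.1.

Lemma winding_lift : exists2 psi : R -> R, continuous psi &
  forall t, 0 <= t <= 1 -> is_arg (C t - p) (psi t).
Proof.
have [|t|t|psi psic psiP] := @lift1 R (fun t => C (clamp t) - p).
- have Dc : continuous (C \o @clamp R).
    by apply: within_cont Cc (@clamp_cont R) _ => t; exact: clamp_in.
  by move=> t; apply: cvgB; [apply: Dc|apply: cvg_cst].
- by rewrite clampK.
- apply/eqP => /eqP; rewrite subr_eq0 => /eqP Ct; case: Ip => + _; apply.
  by rewrite -Ct; apply: trace_in; exact: clampP.
by exists psi => // t t01; have := psiP t; rewrite clamp_id.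
Qed.

Variable psi : R -> R.
Hypothesis psic : continuous psi.
Hypothesis psiP : forall t, 0 <= t <= 1 -> is_arg (C t - p) (psi t).

(* The angle of [C t - p] along [C] cut open at the parameter [r]. *)
Definition cut_angle (r t : R) := if r < t then psi t else psi t + (psi 1 - psi 0).

Lemma arc_sub (a b : R) : 0 <= a -> b <= 1 -> C @` `[a, b] `<=` trace C.
Proof.
move=> a0 b1 _ [t + <-]; rewrite /= in_itv /= => /andP[ta tb].
by apply: trace_in; apply/andP; split; lra.
Qed.

Lemma within_C (a b : R) : 0 <= a -> b <= 1 -> {within `[a, b], continuous C}.
Proof.
move=> a0 b1; apply: within_sub Cc => t; rewrite /= !in_itv /= => /andP[ta tb].
by apply/andP; split; lra.
Qed.

(** The short arc [Q] is so close to [C s] that, seen from [p], it lies in a half-plane, where the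
    continuous angle varies exactly as [ang]. If [Q] passes through [C 0], a cut at [r] off [Q]
    falls between the two parameters, and the added total turn [psi 1 - psi 0] closes the gap. *)
Lemma near_arc (e : R) : 0 < e -> exists2 d, 0 < d &
  forall s t, 0 <= s < 1 -> 0 <= t < 1 -> ball (C s) d (C t) ->
  exists Q : set pt, [/\ Q `<=` trace C, forall z, Q z -> ball (C s) e z,
    pathin Q (C s) (C t) &
    forall r, 0 <= r < 1 -> ~ Q (C r) ->
      cut_angle r t - cut_angle r s = ang (C s - p) (C t - p)].
Proof.
move=> e0; have [e1 e10 e1P] := interior_ball HC Ip.
pose e2 := Num.min (e / 2) (e1 / 4).
have e20 : 0 < e2 by rewrite /e2 lt_min !divr_gt0.
have e2e : e2 <= e / 2 by rewrite /e2 ge_min lexx.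
have e2e1 : e2 <= e1 / 4 by rewrite /e2 ge_min lexx orbT.
have dotp s z : 0 <= s <= 1 -> ball (C s) e2 z -> 0 < dot (C s - p) (z - p).
  move=> s01 /ballP2[z1 z2]; apply: (@dot_pos _ _ _ e1) => //=.
  - have nb : ~ ball p e1 (C s) by move=> /e1P[_]; apply; apply: trace_in.
    apply: contrapT => /not_orP[/negP n1 /negP n2]; apply: nb; apply/ballP2.
    by rewrite ![`|p.1 - _|]distrC ![`|p.2 - _|]distrC !ltNge.
  - by rewrite (_ : _ - _ = (C s).1 - z.1); [lra|ring].
  - by rewrite (_ : _ - _ = (C s).2 - z.2); [lra|ring].
have anc z : {within [set t | 0 <= t <= 1 /\ 0 < dot (z - p) (C t - p)],
    continuous (fun t => ang (z - p) (C t - p))}.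
  pose F (y : pt) := ang (z - p) (y - p).
  rewrite (_ : (fun t => _) = F \o C) //.
  apply: (@within_comp _ _ _ _ [set y | 0 < dot (z - p) (y - p)]).
  - apply/subspace_continuousP => y /= dy.
    apply: cvg_within_filter; apply: (@ang_cont R pt (fun=> z - p) (fun y => y - p) y) => //.
      by move=> ?; apply: cvg_cst.
    by move=> ?; apply: cvgB; [apply: cvg_id|apply: cvg_cst].
  - by apply: within_sub Cc => t /= [t01 _]; rewrite in_itv.
  - by move=> t [].
have arc_angle z a b : 0 <= a -> a <= b -> b <= 1 -> (exists t, is_arg (z - p) t) ->
    (forall u, a <= u <= b -> 0 < dot (z - p) (C u - p)) ->
    psi b - psi a = ang (z - p) (C b - p) - ang (z - p) (C a - p).
  move=> a0 ab b1 [t0 t0P] dz.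
  have <- : (t0 + ang (z - p) (C b - p)) - (t0 + ang (z - p) (C a - p)) =
      ang (z - p) (C b - p) - ang (z - p) (C a - p) by ring.
  apply: (@arg_path_unique _ (fun u => C u - p) (fun u => C u - p) psi
    (fun u => t0 + ang (z - p) (C u - p))) => //.
  - exact: cont_within.
  - have H : {within `[a, b], continuous (fun t => ang (z - p) (C t - p))}.
      apply: within_sub (anc z) => u; rewrite /= in_itv /= => uab; split; last exact: dz.
      by move: uab => /andP[? ?]; apply/andP; split; lra.
    by move=> u; apply: cvgD; [apply: cvg_cst|apply: H].
  - by move=> u /andP[? ?]; apply: psiP; apply/andP; split; lra.
  - by move=> u uab; apply: arg_ang t0P (dz _ uab).
  - by left.
have [d d0 dP] := short_arc HC e20.
have [d' d'0 d'P] : exists2 d', 0 < d' & d' <= d /\ d' <= e / 2.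
  by exists (Num.min d (e / 2)); rewrite ?lt_min ?d0 ?divr_gt0 // !ge_min !lexx orbT.
have main s t : 0 <= s -> s <= t -> t < 1 -> ball (C s) d' (C t) ->
  exists Q : set pt, [/\ Q `<=` trace C, forall z, Q z -> ball (C s) e2 z,
    pathin Q (C s) (C t) &
    forall r, 0 <= r < 1 -> ~ Q (C r) ->
      cut_angle r t - cut_angle r s = ang (C s - p) (C t - p)].
  move=> s0 st t1 b; have {b}b : ball (C s) d (C t) by apply: le_ball b; case: d'P.
  have s01 : 0 <= s <= 1 by apply/andP; split; lra.
  have exs : exists r, is_arg (C s - p) r by exists (psi s); apply: psiP.
  have [Q1|Q2] := dP _ _ s0 st t1 b.
    exists (C @` `[s, t]); split.
    - by apply: arc_sub => //; exact: ltW.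
    - by move=> _ [u + <-]; rewrite /= in_itv /= => /Q1.
    - by apply: pathin_image => //; [apply: within_C => //; exact: ltW|apply/andP; split..].
    move=> r /andP[r0 r1] nQ.
    have rst : ~ (s <= r <= t).
      by move=> rst; apply: nQ; exists r => //; rewrite /= in_itv.
    have -> : cut_angle r t - cut_angle r s = psi t - psi s.
      rewrite /cut_angle; case: (ltP r t) => rt; case: (ltP r s) => rs //; try lra.
    rewrite (arc_angle (C s) s t) ?angxx ?subr0 //; first exact: ltW.
    by move=> u ust; apply: dotp => //; apply: Q1.
  exists (C @` `[0, s] `|` C @` `[t, 1]); split.
  - by move=> z []; apply: arc_sub; rewrite ?lexx //; lra.
  - by move=> _ [] [u + <-]; rewrite /= in_itv /= => ?; apply: Q2; auto.
  - apply: (@pathin_trans _ _ _ (C 0)).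
      apply: pathin_sub (_ : pathin (C @` `[0, s]) _ _); first by move=> z; left.
      by apply: pathin_image => //; [apply: within_C; lra|apply/andP; split..].
    rewrite C01; apply: pathin_sub (_ : pathin (C @` `[t, 1]) _ _); first by move=> z; right.
    by apply: pathin_image => //; [exact: ltW|apply: within_C; lra|
      apply/andP; split => //; exact: ltW..].
  move=> r /andP[r0 r1] nQ.
  have sr : s < r.
    by rewrite ltNge; apply/negP => rs; apply: nQ; left; exists r; rewrite //= in_itv /= r0.
  have rt : r < t.
    by rewrite ltNge; apply/negP => rs; apply: nQ; right; exists r; rewrite //= in_itv /= rs ltW.
  rewrite /cut_angle rt ltNge (ltW sr) /=.
  have E1 := arc_angle (C s) 0 s (lexx _) s0 (ltW (le_lt_trans st t1)) exs.
  have E2 := arc_angle (C s) t 1 (ltW (lt_trans (le_lt_trans s0 sr) rt)) (ltW t1) (lexx _) exs.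
  have {}E1 := E1 (fun u us => dotp _ _ s01 (Q2 u (or_introl us))).
  have {}E2 := E2 (fun u us => dotp _ _ s01 (Q2 u (or_intror us))).
  by move: E1 E2; rewrite angxx C01; lra.
exists d' => // s t /andP[s0 s1] /andP[t0 t1] b.
have [st|/ltW ts] := leP s t.
  have [Q [Q1 Q2 Q3 Q4]] := main s t s0 st t1 b.
  by exists Q; split=> // z /Q2; apply: le_ball; lra.
have [Q [Q1 Q2 Q3 Q4]] := main t s t0 ts s1 (ball_sym b).
exists Q; split=> //.
- move=> z /Q2 tz; rewrite (splitr e); apply: ball_triangle (_ : ball _ _ (C t)) _.
    by apply: le_ball b; case: d'P.
  by apply: le_ball tz; lra.
- exact: pathin_sym.
- by move=> r r01 nQ; have := Q4 r r01 nQ; rewrite [in X in _ -> X]angC; lra.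
Qed.

Lemma exterior_setup : exists M e : R, [/\ 0 < M, 0 < e,
  forall z, M <= `|z.1 - p.1| \/ M <= `|z.2 - p.2| -> U z &
  forall z, U z \/ trace C z -> e <= `|z.1 - p.1| \/ e <= `|z.2 - p.2|].
Proof.
have [M M0 MP] := trace_bounded HC; have [e e0 eP] := interior_ball HC Ip.
exists (M + Num.max `|p.1| `|p.2|), e; split=> //.
- by rewrite ltr_pwDl // le_max normr_ge0.
- move=> z H; apply: far_exterior M0 MP _.
  have m1 : `|p.1| <= Num.max `|p.1| `|p.2| by rewrite le_max lexx.
  have m2 : `|p.2| <= Num.max `|p.1| `|p.2| by rewrite le_max lexx orbT.
  by case: H => H; [left; have := ler_normB z.1 p.1|right; have := ler_normB z.2 p.2]; lra.
move=> z H; apply: contrapT => /not_orP[/negP n1 /negP n2].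
have /eP[nU nC] : ball p e z.
  by apply/ballP2; rewrite ![`|p.1 - _|]distrC ![`|p.2 - _|]distrC !ltNge.
by case: H.
Qed.

(** If a ball around [C t] missed the exterior, segments leaving the exterior would meet [C] only
    away from [C t]. There the angle cut at [t] is a single-valued function agreeing locally with
    [ang], and its differences would form the cocycle excluded by [no_angular_cocycle]. *)
Lemma boundary_exterior t e : 0 <= t < 1 -> 0 < e -> exists2 u, U u & ball (C t) e u.
Proof.
move=> t01 e0; apply: contrapT => nU.
have e20 : 0 < e / 2 by rewrite divr_gt0.
have [d d0 dP] := near_arc e20.
have [M [eps [M0 eps0 far away]]] := exterior_setup.
have [tau tauP] : exists tau : pt -> R, forall z, trace C z ->
    0 <= tau z < 1 /\ C (tau z) = z.
  have H z : exists t, trace C z -> 0 <= t < 1 /\ C t = z.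
    have [Cz|nCz] := pselect (trace C z); last by exists 0.
    by have [s s01 Cs] := traceP HC Cz; exists s.
  by have [f fP] := choice H; exists f.
pose Z : set pt := [set z | trace C z /\ ~ ball (C t) (e / 2) z].
(* Off [Z] any value would do: differences are additive anyway, and only those on [Z] are compared
   with [ang]. *)
pose b z := if `[< Z z >] then cut_angle t (tau z) else 0.
apply: (@no_angular_cocycle _ p U Z (fun x y => b y - b x) eps (d / 2) M) => //.
- by rewrite divr_gt0.
- by move=> z [|[Cz _]] => [?|]; apply: away; [left|right].
- by move=> z [Cz _]; apply: trace_sub.
- move=> x y Ux Uy; have [s [s01 Cs sU]] := cross_trace HC Ux Uy.
  exists (seg x y s) => [|q r qx qy]; last exact: seg_ball.
  split=> // bs; apply: nU.
  have s0 : 0 < s.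
    move: (s01) => /andP[s0 _]; rewrite lt_neqAle s0 andbT; apply/eqP => s00.
    by move: Cs; rewrite -s00 seg0; case: Ux.
  have [n n0 nP] := (cont_eps _).1 (@seg_cont _ x y) s _ e20.
  pose s' := Num.max 0 (s - n / 2).
  have s's : 0 <= s' < s by rewrite /s' le_max lexx gt_max s0 /=; lra.
  have s1 : s - n / 2 <= s' by rewrite /s' le_max lexx orbT.
  exists (seg x y s'); first exact: sU.
  rewrite (splitr e); apply: ball_triangle bs (nP _ _).
  by apply/ballR; move: s's => /andP[_ ?]; rewrite ger0_norm; lra.
- by move=> *; ring.
move=> q x y [Cx nx] [Cy ny] qx qy.
have [tx Ex] := tauP _ Cx; have [ty Ey] := tauP _ Cy.
have xy : ball (C (tau x)) d (C (tau y)).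
  by rewrite Ex Ey (splitr d); apply: ball_triangle (ball_sym qx) qy.
have [Q [_ Qe _ QP]] := dP _ _ tx ty xy.
rewrite /b !asboolT // QP // ?Ex ?Ey // => /Qe; rewrite Ex => /ball_sym.
exact: nx.
Qed.

End Boundary.

(** * Directions seen from the exterior, and the crossing of paths *)

Section Crossing.
Variable R : realType.
Local Notation pt := (R * R)%type.
Variable C : R -> pt.
Hypothesis HC : simple_closed_curve C.
Variable p : pt.
Hypothesis Ip : curve_interior C p.
Local Notation U := (exterior C).

Let Cc : {within `[0, 1], continuous C} := HC.1.
Let C01 : C 0 = C 1 := HC.2.1.

Definition liftable (Z : set pt) (w : pt) := exists2 th : pt -> R,
  {within Z, continuous th} & forall z, Z z -> is_arg (z - w) (th z).

Lemma liftable_step (Z : set pt) (v w : pt) :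
  (forall z, Z z -> 0 < dot (z - v) (z - w)) -> liftable Z v -> liftable Z w.
Proof.
move=> dZ [th thc thP]; exists (fun z => th z + ang (z - v) (z - w)).
  have angc : {within Z, continuous (fun z => ang (z - v) (z - w))}.
    apply/subspace_continuousP => y Zy; apply: cvg_within_filter.
    apply: (@ang_cont R pt (fun z => z - v) (fun z => z - w) y); last exact: dZ.
      by move=> ?; apply: cvgB; [apply: cvg_id|apply: cvg_cst].
    by move=> ?; apply: cvgB; [apply: cvg_id|apply: cvg_cst].
  by move=> z; apply: cvgD; [apply: thc|apply: angc].
by move=> z Zz; apply: arg_ang; [apply: thP|apply: dZ].
Qed.

(** Moving the viewpoint by less than a quarter of its distance to [Z] turns each direction by less
    than a right angle, and this change depends continuously on [z]. *)
Lemma liftable_near (Z : set pt) (v w : pt) (e : R) : 0 < e ->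
  (forall z, Z z -> ~ ball v e z) -> ball v (e / 4) w ->
  liftable Z v <-> liftable Z w.
Proof.
move=> e0 Zv /ballP2[w1 w2].
have dZ z : Z z -> 0 < dot (z - v) (z - w).
  move=> /Zv nb; apply: (@dot_pos _ (z - v) (z - w) e) => //=.
  - apply: contrapT => /not_orP[/negP n1 /negP n2]; apply: nb; apply/ballP2.
    by rewrite ![`|v.1 - _|]distrC ![`|v.2 - _|]distrC !ltNge.
  - by rewrite distrC (_ : _ - _ = v.1 - w.1) //; ring.
  - by rewrite distrC (_ : _ - _ = v.2 - w.2) //; ring.
by split; apply: liftable_step => z /dZ //; rewrite dotC.
Qed.

(** The viewpoints from which the closed region is liftable form an open and closed part of the
    component of [u]. It is nonempty because from a far point the region lies in an open half-plane;
    the distance [4 * M] matches the factor 4 in [dot_pos]. *)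
Lemma exterior_liftable u : U u -> liftable (~` U) u.
Proof.
move=> Uu; set A := connected_component (~` trace C) u.
have AU v : A v -> U v.
  move=> Av; split; first exact: (connected_component_sub Av).
  by rewrite -(same_connected_component Av); case: Uu.
pose good v r := 0 < r /\ forall w, ball v r w ->
  (liftable (~` U) v <-> liftable (~` U) w).
have goodP v : A v -> exists r, good v r.
  move=> /AU Uv; have [e e0 eU] := exterior_ball HC Uv.
  exists (e / 4); split; first by rewrite divr_gt0.
  by move=> w; apply: liftable_near => // z nUz /eU.
pose O (P : pt -> Prop) := \bigcup_(vr in [set vr : pt * R |
   [/\ A vr.1, P vr.1 & good vr.1 vr.2]]) ball vr.1 vr.2.
have O_open P : open (O P).
  by apply: bigcup_open => -[v r] /= [_ _ [r0 _]]; apply: ball_open.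
have OP P w : A w -> P w -> O P w.
  move=> Aw Pw; have [r rw] := goodP _ Aw; exists (w, r) => //=.
  by apply: ballxx; case: rw.
pose B := A `&` [set v | liftable (~` U) v].
have BO : B = A `&` O (liftable (~` U)).
  apply/seteqP; split=> w [Aw H]; split=> //; first exact: OP.
  by case: H => -[v r] /= [Av Lv [r0 /(_ w)H]] /H[]; auto.
have BO' : B = A `&` ~` O (fun v => ~ liftable (~` U) v).
  apply/seteqP; split=> w [Aw H]; split=> //.
    by move=> [[v r] /= [Av Lv [r0 /(_ w)H']] /H'[]]; auto.
  by apply: contrapT => nL; apply: H; apply: OP.
have [M M0 MP] := trace_bounded HC.
have [v Av vM] : exists2 v, A v & 4 * M <= `|v.1| \/ 4 * M <= `|v.2|.
  apply: contrapT => H; case: Uu => _; apply; exists (4 * M); split; first exact: num_real.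
  move=> x xM v Av /=; rewrite prod_normE /= ge_max.
  apply/andP; split; apply: (le_trans _ (ltW xM)); rewrite leNgt; apply/negP => lt;
    by apply: H; exists v => //; [left + right]; exact: ltW.
have Lv : liftable (~` U) v.
  have v0 : - v != 0.
    by rewrite oppr_eq0; apply: contraPneq vM => ->; rewrite /= normr0; case; lra.
  have [t0 t0P] := arg_exists v0.
  have dv z : (~` U) z -> 0 < dot (- v) (z - v).
    move=> nUz; apply: (@dot_pos _ (- v) (z - v) (4 * M)) => /=.
    - by lra.
    - by rewrite !normrN.
    - rewrite (_ : _ - _ = - z.1); last by ring.
      rewrite normrN ltNge; apply/negP => h; apply: nUz.
      by apply: far_exterior M0 MP _; left; lra.
    - rewrite (_ : _ - _ = - z.2); last by ring.
      rewrite normrN ltNge; apply/negP => h; apply: nUz.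
      by apply: far_exterior M0 MP _; right; lra.
  exists (fun z => t0 + ang (- v) (z - v)); last first.
    by move=> z /dv; apply: arg_ang.
  have angc : {within ~` U, continuous (fun z => ang (- v) (z - v))}.
    apply/subspace_continuousP => y Zy; apply: cvg_within_filter.
    apply: (@ang_cont R pt (fun=> - v) (fun z => z - v) y); last exact: dv.
      by move=> ?; apply: cvg_cst.
    by move=> ?; apply: cvgB; [apply: cvg_id|apply: cvg_cst].
  by move=> z; apply: cvgD; [apply: cvg_cst|apply: angc].
have BA : B = A.
  apply: (@component_connected _ (~` trace C) u).
  - by exists v.
  - by exists (O (liftable (~` U))).
  - by exists (~` O (fun v => ~ liftable (~` U) v)) => //; apply: open_closedC.
have : A u by apply: connected_component_refl; case: Uu.
by rewrite -BA => -[].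
Qed.

(** By [boundary_exterior] some exterior viewpoint is closer to [C t] than a quarter of the distance
    from [C t] to [Z], and can replace it. *)
Lemma boundary_liftable (Z : set pt) (t : R) : 0 <= t < 1 -> compact Z ->
  Z `<=` ~` U -> ~ Z (C t) -> liftable Z (C t).
Proof.
move=> t01 cZ ZU nZ; have [e e0 eP] := compact_ball_free cZ nZ.
have [psi psic psiP] := winding_lift HC Ip.
have [u Uu tu] := boundary_exterior HC Ip psic psiP t01 (divr_gt0 e0 (ltr0Sn R 3)).
apply/(liftable_near e0 _ tu); first by move=> z Zz /eP.
have [th thc thP] := exterior_liftable Uu; exists th; last by move=> z /ZU/thP.
exact: within_sub ZU thc.
Qed.

(** In the coordinates [(s, t - s)] the strip is part of a rectangle, to which [lift2] applies once
    [t] is clamped at 1. Where clamping acts, [s] exceeds [n], so the chord still does not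
    vanish. *)
Lemma strip_lift (n : R) : 0 < n -> n < 1 / 2 -> exists2 th : pt -> R, continuous th &
  forall s t, 0 <= s -> t <= 1 -> n <= t - s -> t - s <= 1 - n ->
    is_arg (C t - C s) (th (s, t - s)).
Proof.
move=> n0 n2.
pose D t := C (clamp t).
have Dc : continuous D.
  by apply: within_cont Cc (@clamp_cont R) _ => t; exact: clamp_in.
pose cl (a b t : R) := a + (b - a) * clamp ((t - a) / (b - a)).
have clc a b : continuous (cl a b).
  move=> t; apply: cvgD; first exact: cvg_cst.
  apply: cvgM; first exact: cvg_cst.
  apply: (cont_comp (@clamp_cont R) (h := fun t => (t - a) / (b - a))) => r.
  by apply: cvgM; [apply: cvgB; [apply: cvg_id|apply: cvg_cst]|apply: cvg_cst].
have clE a b t : a < b -> a <= t <= b -> cl a b t = t.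
  move=> ab /andP[ta tb]; rewrite /cl clamp_id.
    by rewrite mulrCA divff ?mulr1; [ring|rewrite subr_eq0 gt_eqF].
  rewrite divr_ge0 ?subr_ge0 ?(ltW ab) //= ler_pdivrMr ?subr_gt0 //; lra.
have clP a b t : a < b -> a <= cl a b t <= b.
  move=> ab; have /andP[c0 c1] := clampP ((t - a) / (b - a)).
  rewrite /cl; apply/andP; split; nra.
pose S (x : pt) := cl 0 (1 - n) (clamp x.1).
pose T (x : pt) := S x + cl n (1 - n) (clamp x.2).
pose G x := D (T x) - D (S x).
have f1 : continuous (fun x : pt => x.1) by apply: cont_fst => ?; apply: cvg_id.
have f2 : continuous (fun x : pt => x.2) by apply: cont_snd => ?; apply: cvg_id.
have Sc : continuous S := cont_comp (clc _ _) (cont_comp (@clamp_cont R) f1).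
have Tc : continuous T.
  by move=> x; apply: cvgD; [apply: Sc|
    apply: (cont_comp (clc _ _) (cont_comp (@clamp_cont R) f2))].
have S0 x : 0 <= S x <= 1 - n by apply: clP; lra.
have T0 x : S x + n <= T x <= S x + (1 - n).
  by rewrite /T !lerD2l; apply: clP; lra.
have [|x|x|th thc thP] := @lift2 R G.
- move=> x; apply: cvgB; first exact: (cont_comp Dc Tc).
  exact: (cont_comp Dc Sc).
- by rewrite /G /T /S /= !clampK.
- rewrite subr_eq0; apply/eqP => /esym.
  have := S0 x; have := T0 x => /andP[? ?] /andP[? ?].
  rewrite /D [clamp (S x)]clamp_id; last by apply/andP; split; lra.
  have [T1|T1] := leP (T x) 1.
    rewrite clamp_id; last by apply/andP; split; lra.
    by apply: (curve_inj HC); lra.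
  rewrite /clamp (min_idPl (ltW T1)) (max_idPr ler01).
  by apply: (curve_inj HC); lra.
exists th => // s t s0 t1 st1 st2.
have := thP (s, t - s); rewrite /G /T /S /=.
rewrite (clamp_id (t := s)); last by apply/andP; split; lra.
rewrite (clamp_id (t := t - s)); last by apply/andP; split; lra.
rewrite clE; [|lra|by apply/andP; split; lra].
rewrite clE; [|lra|by apply/andP; split; lra].
rewrite /D [s + _]addrC subrK !clamp_id //; apply/andP; split; lra.
Qed.

Lemma lift_path (Z : set pt) (w : pt) (lam : pt -> R) (u v : R -> pt)
    (k : R -> R) (x y : R) : x <= y ->
  {within Z, continuous lam} -> (forall z, Z z -> is_arg (z - w) (lam z)) ->
  {within `[x, y], continuous u} -> (forall r, x <= r <= y -> Z (u r)) ->
  continuous k -> (forall r, x <= r <= y -> is_arg (v r) (k r)) ->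
  (forall r, x <= r <= y -> v r = u r - w \/ v r = - (u r - w)) ->
  lam (u y) - lam (u x) = k y - k x.
Proof.
move=> xy lc lP uc uZ kc kP vu.
apply: (@arg_path_unique _ (fun r => u r - w) v (lam \o u) k) => //.
- by apply: within_comp lc uc _ => t; rewrite /= in_itv /=; apply: uZ.
- exact: cont_within.
- by move=> r rxy; apply/lP/uZ.
Qed.

(* [lra] inspects the whole context, which is large below. *)
Ltac alra := repeat match goal with H : ?T |- _ =>
    lazymatch T with
    | is_true _ => fail
    | Real.sort _ => fail
    | Real.type => fail
    | _ => clear H
    end
  end; lra.

(* If the two paths were disjoint, [f s - g t] would have an angle on the whole
   square.  Replacing each path by an arc of [C], which is legitimate because
   the endpoints of the other path are limits of exterior points, the total
   variation along the boundary of the square becomes twice the angle between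
   [C 1 - C b] and [C b - C 0], an odd multiple of [pi]. *)
Lemma crossing (X Y : set pt) a b c d : X `<=` ~` U -> Y `<=` ~` U ->
  0 <= a -> a < b -> b < c -> c < d -> d < 1 ->
  pathin X (C a) (C c) -> pathin Y (C b) (C d) -> exists z, X z /\ Y z.
Proof.
move=> XU YU a0 ab bc cd d1 [f [fc f0 f1 fX]] [g [gc g0 g1 gY]].
apply: contrapT => nXY; have fg s t : f s <> g t.
  by move=> E; apply: nXY; exists (f s); split; rewrite // E.
have [Th Thc ThP] : exists2 Th : pt -> R, continuous Th &
    forall s t, 0 <= s <= 1 -> 0 <= t <= 1 -> is_arg (f s - g t) (Th (s, t)).
  have [|x|x|Th Thc ThP] := @lift2 R (fun x => f (clamp x.1) - g (clamp x.2)).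
  - move=> x; apply: cvgB.
      apply: (cont_comp fc (cont_comp (@clamp_cont R) _)).
      by apply: cont_fst => ?; apply: cvg_id.
    apply: (cont_comp gc (cont_comp (@clamp_cont R) _)).
    by apply: cont_snd => ?; apply: cvg_id.
  - by rewrite /= !clampK.
  - by rewrite subr_eq0; apply/eqP.
  by exists Th => // s t s01 t01; have := ThP (s, t); rewrite /= !clamp_id.
(* With this slack every chord used below joins parameters at least [n] apart, also around
   [C 0 = C 1]. *)
pose n := Num.min (1 / 4) (Num.min (Num.min (b - a) (c - b)) (Num.min (d - c) (1 - d))).
have n0 : 0 < n by rewrite !lt_min !subr_gt0 ab bc cd d1 divr_gt0.
have [n1 n2 n3 n4 n5] : [/\ n <= 1 / 4, n <= b - a, n <= c - b, n <= d - c & n <= 1 - d].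
  by split; rewrite /n !ge_min lexx ?orbT.
have [th0 th0c th0P] := @strip_lift n n0 ltac:(alra).
pose th s t := th0 (s, t - s).
have thc1 t : continuous (fun s => th s t).
  apply: cont_comp th0c _; apply: cont_pair => s; first exact: cvg_id.
  by apply: cvgB; [apply: cvg_cst|apply: cvg_id].
have thc2 s : continuous (th s).
  apply: cont_comp th0c _; apply: cont_pair => t; first exact: cvg_cst.
  by apply: cvgB; [apply: cvg_id|apply: cvg_cst].
have Thc1 t : continuous (fun s => Th (s, t)).
  by apply: cont_comp Thc _; apply: cont_pair => s; [apply: cvg_id|apply: cvg_cst].
have Thc2 s : continuous (fun t => Th (s, t)).
  by apply: cont_comp Thc _; apply: cont_pair => t; [apply: cvg_cst|apply: cvg_id].
have arcK x y : 0 <= x -> y <= 1 -> compact (C @` `[x, y]).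
  move=> x0 y1; apply: continuous_compact; last exact: segment_compact.
  by apply: within_C.
have arcU x y : 0 <= x -> y <= 1 -> C @` `[x, y] `<=` ~` U.
  by move=> x0 y1 z /(arc_sub x0 y1); apply: trace_sub.
have fK : compact (f @` `[0, 1]).
  by apply: continuous_compact; [exact: cont_within|exact: segment_compact].
have gK : compact (g @` `[0, 1]).
  by apply: continuous_compact; [exact: cont_within|exact: segment_compact].
have fU : f @` `[0, 1] `<=` ~` U by move=> _ [t _ <-]; apply: XU.
have gU : g @` `[0, 1] `<=` ~` U by move=> _ [t _ <-]; apply: YU.
have nf t0 : ~ (f @` `[0, 1]) (g t0) by move=> [t _]; apply: fg.
have ng t0 : ~ (g @` `[0, 1]) (f t0) by move=> [t _ /esym]; apply: fg.
have narc x y t : 0 <= x -> y <= 1 -> 0 < t -> t < 1 -> (t < x \/ y < t) ->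
    ~ (C @` `[x, y]) (C t).
  move=> x0 y1 t0 t1 xy [s + E]; rewrite /= in_itv /= => /andP[xs sy].
  case: xy => h.
    by apply: (@curve_inj _ _ HC t s) (esym E); alra.
  by apply: (@curve_inj _ _ HC s t) E; alra.
have narc0 x y t : 0 < x -> y < 1 -> 0 <= t -> (t < x) -> ~ (C @` `[x, y]) (C t).
  move=> x0 y1 t0 tx [s + E]; rewrite /= in_itv /= => /andP[xs sy].
  by apply: (@curve_inj _ _ HC t s) (esym E); alra.
have arcI x y r : x <= r <= y -> (C @` `[x, y]) (C r).
  by move=> xy; exists r; rewrite //= in_itv.
have fI r : 0 <= r <= 1 -> (f @` `[0, 1]) (f r) by move=> ?; exists r; rewrite //= in_itv.
have gI r : 0 <= r <= 1 -> (g @` `[0, 1]) (g r) by move=> ?; exists r; rewrite //= in_itv.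
have cu3 (A B E : set pt) : compact A -> compact B -> compact E -> compact (A `|` B `|` E).
  by move=> *; do 2?[apply: compactU => //].
(* The arc replacing a path must avoid the viewpoint: seen from [C b] and [C c] it passes through
   [C 0 = C 1], whereas seen from [C d] and [C a] it is [[a, c]] and [[b, d]]. *)
have [lb lbc lbP] : liftable (f @` `[0, 1] `|` C @` `[0, a] `|` C @` `[c, 1]) (C b).
  apply: boundary_liftable; first by apply/andP; split; alra.
  - by apply: cu3 => //; apply: arcK; alra.
  - by move=> z [[/fU//|]|]; apply: arcU; alra.
  - by rewrite -g0 => -[[/nf//|]|]; rewrite g0; apply: narc; alra.
have [mc mcc mcP] : liftable (g @` `[0, 1] `|` C @` `[0, b] `|` C @` `[d, 1]) (C c).
  apply: boundary_liftable; first by apply/andP; split; alra.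
  - by apply: cu3 => //; apply: arcK; alra.
  - by move=> z [[/gU//|]|]; apply: arcU; alra.
  - by rewrite -f1 => -[[/ng//|]|]; rewrite f1; apply: narc; alra.
have [ld ldc ldP] : liftable (f @` `[0, 1] `|` C @` `[a, c]) (C d).
  apply: boundary_liftable; first by apply/andP; split; alra.
  - by apply: compactU => //; apply: arcK; alra.
  - by move=> z [/fU//|]; apply: arcU; alra.
  - by rewrite -g1 => -[/nf//|]; rewrite g1; apply: narc; alra.
have [ma mac maP] : liftable (g @` `[0, 1] `|` C @` `[b, d]) (C a).
  apply: boundary_liftable; first by apply/andP; split; alra.
  - by apply: compactU => //; apply: arcK; alra.
  - by move=> z [/gU//|]; apply: arcU; alra.
  - by rewrite -f0 => -[/ng//|]; rewrite f0; apply: narc0; alra.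
have CW x y : 0 <= x -> y <= 1 -> {within `[x, y], continuous C}.
  by move=> x0 y1; apply: within_C.
have thP s t : 0 <= s -> t <= 1 -> n <= t - s -> t - s <= 1 - n ->
  is_arg (C t - C s) (th s t) by exact: th0P.
have E1 : lb (f 1) - lb (f 0) = Th (1, 0) - Th (0, 0).
  apply: (@lift_path _ _ lb f (fun s => f s - g 0) (fun s => Th (s, 0)) 0 1 ler01 lbc lbP) => //.
  - exact: cont_within.
  - by move=> r r01; left; left; apply: fI.
  - by move=> r r01; apply: ThP; rewrite // lexx ler01.
  - by move=> r _; left; rewrite g0.
have E2 : lb (C 1) - lb (C c) = th b 1 - th b c.
  apply: (@lift_path _ _ lb C (fun t => C t - C b) (th b) c 1 _ lbc lbP) => //.
  - alra.
  - by apply: CW; alra.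
  - by move=> r rc; right; apply: arcI.
  - by move=> r /andP[? ?]; apply: thP; alra.
  - by left.
have E3 : lb (C a) - lb (C 0) = th a b - th 0 b.
  apply: (@lift_path _ _ lb C (fun s => C b - C s) (fun s => th s b) 0 a _ lbc lbP) => //.
  - by apply: CW; alra.
  - by move=> r rc; left; right; apply: arcI.
  - by move=> r /andP[? ?]; apply: thP; alra.
  - by move=> r _; right; rewrite opprB.
have E4 : mc (g 1) - mc (g 0) = Th (1, 1) - Th (1, 0).
  apply: (@lift_path _ _ mc g (fun t => f 1 - g t) (fun t => Th (1, t)) 0 1 ler01 mcc mcP) => //.
  - exact: cont_within.
  - by move=> r r01; left; left; apply: gI.
  - by move=> r r01; apply: ThP; rewrite // lexx ler01.
  - by move=> r _; right; rewrite f1 opprB.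
have E5 : mc (C 1) - mc (C d) = th c 1 - th c d.
  apply: (@lift_path _ _ mc C (fun t => C t - C c) (th c) d 1 _ mcc mcP) => //.
  - alra.
  - by apply: CW; alra.
  - by move=> r rc; right; apply: arcI.
  - by move=> r /andP[? ?]; apply: thP; alra.
  - by left.
have E6 : mc (C b) - mc (C 0) = th b c - th 0 c.
  apply: (@lift_path _ _ mc C (fun s => C c - C s) (fun s => th s c) 0 b _ mcc mcP) => //.
  - alra.
  - by apply: CW; alra.
  - by move=> r rc; left; right; apply: arcI.
  - by move=> r /andP[? ?]; apply: thP; alra.
  - by move=> r _; right; rewrite opprB.
have E7 : ld (f 1) - ld (f 0) = Th (1, 1) - Th (0, 1).
  apply: (@lift_path _ _ ld f (fun s => f s - g 1) (fun s => Th (s, 1)) 0 1 ler01 ldc ldP) => //.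
  - exact: cont_within.
  - by move=> r r01; left; apply: fI.
  - by move=> r r01; apply: ThP; rewrite // lexx ler01.
  - by move=> r _; left; rewrite g1.
have E8 : ld (C c) - ld (C a) = th c d - th a d.
  apply: (@lift_path _ _ ld C (fun s => C d - C s) (fun s => th s d) a c _ ldc ldP) => //.
  - alra.
  - by apply: CW; alra.
  - by move=> r rc; right; apply: arcI.
  - by move=> r /andP[? ?]; apply: thP; alra.
  - by move=> r _; right; rewrite opprB.
have E9 : ma (g 1) - ma (g 0) = Th (0, 1) - Th (0, 0).
  apply: (@lift_path _ _ ma g (fun t => f 0 - g t) (fun t => Th (0, t)) 0 1 ler01 mac maP) => //.
  - exact: cont_within.
  - by move=> r r01; left; apply: gI.
  - by move=> r r01; apply: ThP; rewrite // lexx ler01.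
  - by move=> r _; right; rewrite f0 opprB.
have E10 : ma (C d) - ma (C b) = th a d - th a b.
  apply: (@lift_path _ _ ma C (fun t => C t - C a) (th a) b d _ mac maP) => //.
  - alra.
  - by apply: CW; alra.
  - by move=> r rc; right; apply: arcI.
  - by move=> r /andP[? ?]; apply: thP; alra.
  - by left.
(* [C r - C 0] and [C 1 - C r] are opposite vectors. *)
have E11 : th 0 c - th 0 b = th c 1 - th b 1.
  apply: (@arg_path_unique _ (fun r => C r - C 0) (fun r => C 1 - C r) (th 0)
    (fun r => th r 1) b c) => //; try exact: cont_within.
  - alra.
  - by move=> r /andP[? ?]; apply: thP; alra.
  - by move=> r /andP[? ?]; apply: thP; alra.
  - by move=> r _; right; rewrite opprB C01.
(* The variations along the four sides cancel; by [E11] what remains is twice this difference. *)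
have m0 : th b 1 - th 0 b = 0.
  move: E1 E2 E3 E4 E5 E6 E7 E8 E9 E10 E11; rewrite f0 f1 g0 g1 C01.
  by clear; move=> *; lra.
have a1 : is_arg (C 1 - C b) (th b 1) by apply: thP; alra.
have a2 : is_arg (C b - C 0) (th 0 b) by apply: thP; alra.
have := arg_opp a2; rewrite opprB C01 => a3.
have := arg_uniq a1 a3; rewrite opprD addrA m0 sub0r.
have lt := lt_trans (ltrN10 R) (ltr01 (R := R)).
by rewrite cosN cospi => h; rewrite h ltxx in lt.
Qed.
End Crossing.

(** * Separators of outerstring graphs *)

Section Strings.
Variable R : realType.
Local Notation pt := (R * R)%type.
Variable C : R -> pt.
Hypothesis HC : simple_closed_curve C.
Variable p : pt.
Hypothesis Ip : curve_interior C p.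
Local Notation U := (exterior C).

Lemma reach_trace z x : ~ U z -> U x -> exists s, [/\ 0 <= s <= 1,
  trace C (seg z x s), forall r, 0 <= r < s -> ~ trace C (seg z x r) &
  forall r, 0 <= r <= s -> ~ U (seg z x r)].
Proof.
move=> nUz Ux.
have [||s [s01 Ps smin]] := @first_hit R (fun s => trace C (seg z x s) \/ s = 1).
- by right.
- move=> t t01 /not_orP[nC t1]; have [e e0 eP] := off_trace_ball HC nC.
  have [d d0 dP] := (cont_eps _).1 (@seg_cont _ z x) t e e0.
  have t1' : 0 < 1 - t by move: t01 => /andP[_ ?]; rewrite subr_gt0 lt_neqAle; apply/andP; split=> //; apply/eqP.
  exists (Num.min d (1 - t)); first by rewrite lt_min d0.
  move=> r r01; rewrite lt_min => /andP[td t1'' ] [Cr|r1].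
    by have [_] := pathin_in (eP _ (dP _ ((ballR _ _ _).2 td))); apply.
  by move: t1''; rewrite r1 distrC ltNge ler_norm.
have off r : 0 <= r < s -> ~ trace C (seg z x r) by move=> /smin/not_orP[].
have inK r : 0 <= r < s -> ~ U (seg z x r).
  move=> /andP[r0 rs] Ur; apply: nUz; apply: exterior_path Ur.
  have := @pathin_image R (seg z x) 0 r r0 (@cont_within _ _ _ _ (@seg_cont _ z x)) r 0.
  rewrite seg0 => /(_ _ _)/pathin_sub; apply; rewrite ?lexx ?r0 //.
  move=> _ [t + <-]; rewrite /= in_itv /= => /andP[t0 tr]; apply: off.
  by rewrite t0 (le_lt_trans tr).
have Cs : trace C (seg z x s).
  case: Ps => // s1; apply: contrapT => nC; apply: nUz; apply: exterior_path Ux.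
  apply/pathin_sym/pathin_seg => t /andP[t0 t1].
  have [ts|ts] := ltP t s; first by apply: off; rewrite t0.
  by rewrite (_ : t = s) //; apply/eqP; rewrite eq_le ts s1 t1.
exists s; split=> // r /andP[r0]; rewrite le_eqVlt => /predU1P[->|rs].
  exact: trace_sub.
by apply: inK; rewrite r0.
Qed.

Variable psi : R -> R.
Hypothesis psic : continuous psi.
Hypothesis psiP : forall t, 0 <= t <= 1 -> is_arg (C t - p) (psi t).

Lemma seg_pathin (z x : pt) (s : R) : 0 <= s -> forall r, 0 <= r <= s ->
  pathin (seg z x @` `[0, s]) z (seg z x r).
Proof.
move=> s0 r rs; rewrite -{2}(seg0 z x); apply: pathin_image => //.
  exact: (@cont_within _ _ _ _ (@seg_cont _ z x)).
by rewrite lexx s0.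
Qed.

(* Where the segment leaves the closed region, it is replaced by a short arc
   of [C]. *)
Lemma local_path (e : R) : 0 < e -> exists2 d, 0 < d & forall z z',
  ~ U z -> ~ U z' -> ball z d z' -> exists P : set pt,
    [/\ P `<=` ~` U, pathin P z z' & forall w, P w -> ball z e w].
Proof.
move=> e0; have e30 : 0 < e / 3 by rewrite divr_gt0.
have [d d0 dP] := near_arc HC Ip psic psiP e30.
exists (Num.min (d / 2) (e / 3)); first by rewrite lt_min e30 divr_gt0.
move=> z z' nUz nUz' zz'.
have zd : ball z (d / 2) z' by apply: le_ball zz'; rewrite ge_min lexx.
have ze : ball z (e / 3) z' by apply: le_ball zz'; rewrite ge_min lexx orbT.
have d20 : 0 < d / 2 by rewrite divr_gt0.
have [inK|] := pselect (forall t, 0 <= t <= 1 -> ~ U (seg z z' t)).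
  exists (seg z z' @` `[0, 1]); split.
  - by move=> _ [t + <-]; rewrite /= in_itv /= => /inK.
  - by rewrite -{2}(seg1 z z'); apply: seg_pathin; rewrite ?lexx ler01.
  - move=> _ [t + <-]; rewrite /= in_itv /= => t01; apply: seg_ball => //.
      exact: ballxx.
    by apply: le_ball ze; lra.
move=> /existsNP[t /not_implyP[t01 /contrapT Ux]]; set x := seg z z' t in Ux.
have [s [s01 Cs _ sK]] := reach_trace nUz Ux.
have [s' [s01' Cs' _ sK']] := reach_trace nUz' Ux.
have inb q r w y k : 0 <= k <= 1 -> ball q r z -> ball q r z' ->
    w = z \/ w = z' -> y = seg w x k -> ball q r y.
  move=> k01 qz qz' hw ->; apply: seg_ball => //; first by case: hw => ->.
  exact: seg_ball.
have zz r : 0 < r -> ball z r z by exact: ballxx.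
set c := seg z x s in Cs; set c' := seg z' x s' in Cs'.
have zc r : 0 < r -> ball z r z' -> ball z r c /\ ball z r c'.
  move=> r0 zr; split.
    exact: (inb z r z c s s01 (zz r r0) zr (or_introl erefl) erefl).
  exact: (inb z r z' c' s' s01' (zz r r0) zr (or_intror erefl) erefl).
have [tc tc01 Ec] := traceP HC Cs; have [tc' tc01' Ec'] := traceP HC Cs'.
have [Q [QC Qe Qp _]] : exists Q : set pt, [/\ Q `<=` trace C,
    forall w, Q w -> ball (C tc) (e / 3) w, pathin Q (C tc) (C tc') & True].
  have [|Q [Q1 Q2 Q3 _]] := dP tc tc' tc01 tc01'; last by exists Q.
  rewrite Ec Ec' (splitr d); have [b1 b2] := zc _ d20 zd.
  exact: ball_triangle (ball_sym b1) b2.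
rewrite Ec Ec' in Qp.
have [s0 s1] := andP s01; have [s0' s1'] := andP s01'.
exists (seg z x @` `[0, s] `|` Q `|` seg z' x @` `[0, s']); split.
- move=> w [[[r + <-]|/QC Cw]|[r + <-]]; rewrite /= ?in_itv /=; [exact: sK| |exact: sK'].
  exact: trace_sub.
- apply: (@pathin_trans _ _ _ c).
    apply: pathin_sub (seg_pathin z x s0 _); first by move=> w ?; left; left.
    by rewrite s0 lexx.
  apply: (@pathin_trans _ _ _ c').
    by apply: pathin_sub Qp => w ?; left; right.
  apply: pathin_sub (pathin_sym (seg_pathin z' x s0' _)); first by move=> w ?; right.
  by rewrite s0' lexx.
have e3e w : ball z (e / 3) w -> ball z e w by apply: le_ball; lra.
move=> w [[[r + <-]|/Qe Qw]|[r + <-]]; rewrite /= ?in_itv /=.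
- move=> /andP[r0 rs]; apply: e3e; apply: (inb z (e / 3) z _ r) => //; last by left.
    by rewrite r0 (le_trans rs).
  exact: ballxx.
- rewrite (_ : e = e / 3 + (e / 3 + e / 3)); last by lra.
  apply: ball_triangle (zc _ e30 ze).1 _; rewrite Ec in Qw.
  by apply: le_ball Qw; lra.
- move=> /andP[r0 rs]; apply: e3e; apply: (inb z (e / 3) z' _ r) => //; last by right.
    by rewrite r0 (le_trans rs).
  exact: ballxx.
Qed.

Variables (V : finType) (e : rel V) (g : V -> R -> pt).
Hypothesis gc : forall v, curve (g v).
Hypothesis gC : forall v, trace C (g v 0).
Hypothesis gK : forall v, trace (g v) `<=` ~` U.
Hypothesis ge : forall u v, u != v -> e u v <-> trace (g u) `&` trace (g v) !=set0.

Definition met (X : set pt) : {set V} := setof (fun v => `[< trace (g v) `&` X !=set0 >]).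

Lemma metP (X : set pt) v : reflect (exists2 z, trace (g v) z & X z) (v \in met X).
Proof.
rewrite in_setof; apply: (iffP (asboolP _)) => [[z [? ?]]|[z ? ?]]; by exists z.
Qed.

Lemma met_sub (X Y : set pt) v : X `<=` Y -> v \in met X -> v \in met Y.
Proof. by move=> XY /metP[z gz /XY Yz]; apply/metP; exists z. Qed.

Lemma met_union (X Y : set pt) m n : (#|met X| <= m)%N -> (#|met Y| <= n)%N ->
  (#|met (X `|` Y)| <= m + n)%N.
Proof.
apply: card_le_union => v /metP[z gz [Xz|Yz]]; [left|right]; apply/metP; by exists z.
Qed.

(** Disjoint compact strings have positive distance, and there are finitely many pairs. It follows
    that the strings meeting a set of small diameter form a clique. *)
Lemma strings_apart : exists2 d, 0 < d & forall u v z z',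
  trace (g u) z -> trace (g v) z' -> ball z d z' -> trace (g u) `&` trace (g v) !=set0.
Proof.
have pair (uv : V * V) : exists2 d, 0 < d & forall z z',
    trace (g uv.1) z -> trace (g uv.2) z' -> ball z d z' ->
    trace (g uv.1) `&` trace (g uv.2) !=set0.
  case: uv => u v /=; have [h|nh] := pselect (trace (g u) `&` trace (g v) !=set0).
    by exists 1.
  have [d d0 dP] : exists2 d, 0 < d & forall z, trace (g u) z ->
      forall z', trace (g v) z' -> ~ ball z d z'.
    apply: (@compact_uniform R pt _ (fun d z => forall z', trace (g v) z' -> ~ ball z d z')).
      exact: (@curve_compact _ _ (@gc u)).
    move=> z uz; have nvz : ~ trace (g v) z by move=> vz; apply: nh; exists z.
    have [d d0 dP] := compact_ball_free (@curve_compact _ _ (@gc v)) nvz.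
    exists (d / 2); first by rewrite divr_gt0.
    move=> y d' zy /andP[_ dd'] z' vz' yz'; apply: (dP z') => //.
    by rewrite (splitr d); apply: ball_triangle zy _; apply: le_ball yz'; exact: ltW.
  by exists d => // z z' uz vz' /(dP _ uz _ vz').
have [D DP] : exists D : V * V -> R, forall uv, 0 < D uv /\ forall z z' : pt,
    trace (g uv.1) z -> trace (g uv.2) z' -> ball z (D uv) z' ->
    trace (g uv.1) `&` trace (g uv.2) !=set0.
  have H (uv : V * V) : exists d : R, 0 < d /\ forall z z' : pt,
      trace (g uv.1) z -> trace (g uv.2) z' -> ball z d z' ->
      trace (g uv.1) `&` trace (g uv.2) !=set0.
    by have [d d0 dP] := pair uv; exists d.
  by have [D DP] := choice H; exists D.
have [d d0 dD] : exists2 d : R, 0 < d & forall uv, d <= D uv.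
  suff [d d0 dD] : exists2 d : R, 0 < d & forall uv, uv \in enum {: V * V} -> d <= D uv.
    by exists d => // uv; apply: dD; rewrite mem_enum.
  elim: (enum _) => [|uv s [d d0 dD]]; first by exists 1.
  exists (Num.min d (D uv)); first by rewrite lt_min d0 (DP uv).1.
  move=> x; rewrite inE => /predU1P[->|/dD h]; first by rewrite ge_min lexx orbT.
  by rewrite ge_min h.
exists d => // u v z z' uz vz' b; apply: (DP (u, v)).2 uz vz' _.
exact: le_ball b.
Qed.

Variables (q l b : nat) (lay : V -> nat).
Hypothesis clique_q : forall S : {set V},
  (forall x y, x \in S -> y \in S -> x != y -> e x y) -> (#|S| <= q)%N.
Hypothesis qb : (q <= b)%N.
Hypothesis lay_lt : forall x, (lay x < l)%N.
Hypothesis lay_b : forall x, (#|up_nbrs e lay x| <= b)%N.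

Lemma met_clique (X : set pt) : (forall u v, u \in met X -> v \in met X ->
  trace (g u) `&` trace (g v) !=set0) -> (#|met X| <= q)%N.
Proof. by move=> h; apply: clique_q => x y xX yX xy; apply/(ge xy)/h. Qed.

(* From a point of a string, follow it towards its root until it meets a
   string of a lower layer, and switch to a lowest such string: in each layer
   only up-neighbours of the single string followed there are met. *)
Lemma string_leg i w y : trace (g y) w -> lay y = i ->
  (forall y', trace (g y') w -> (i <= lay y')%N) ->
  exists X t, [/\ X `<=` ~` U, pathin X w (C t), 0 <= t < 1 & (#|met X| <= i.+1 * b)%N].
Proof.
have [n] := ubnP i; elim: n i w y => // n IH i w y; rewrite ltnS => le_in yw yi wmin.
have [t1 + Et1] := yw; rewrite /= in_itv /= => t101.
pose h (s : R) := g y (clamp (t1 * (1 - s))).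
have hc : continuous h.
  have kc : continuous (fun s : R => t1 * (1 - s)).
    by move=> s; apply: cvgM; [apply: cvg_cst|apply: cvgB; [apply: cvg_cst|apply: cvg_id]].
  exact: (@within_cont _ _ _ _ _ (g y) _ (@gc y) (cont_comp (@clamp_cont R) kc)
    (fun t => clamp_in _)).
have hy s : trace (g y) (h s) by exists (clamp (t1 * (1 - s))) => //; exact: clamp_in.
have h0 : h 0 = w by rewrite /h subr0 mulr1 clamp_id.
have h1 : h 1 = g y 0 by rewrite /h subrr mulr0 clamp0.
pose low s := exists2 y', trace (g y') (h s) & (lay y' < i)%N.
have [||s [s01 Ps smin]] := @first_hit R (fun s => low s \/ s = 1).
- by right.
- move=> t t01 /not_orP[nlow t1n].
  have t1' : 0 < 1 - t.
    by move: t01 => /andP[_ ?]; rewrite subr_gt0 lt_neqAle; apply/andP; split=> //; apply/eqP.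
  have each v : exists2 d, 0 < d & forall s, `|t - s| < d -> trace (g v) (h s) ->
      (i <= lay v)%N.
    have [il|il] := leqP i (lay v); first by exists 1.
    have nv : ~ trace (g v) (h t) by move=> vt; apply: nlow; exists v.
    have [e1 e10 e1P] := compact_ball_free (@curve_compact _ _ (@gc v)) nv.
    have [d d0 dP] := (cont_eps _).1 hc t e1 e10.
    by exists d => // s ts /e1P; case; apply/dP/ballR.
  have [d d0 dP] : exists2 d, 0 < d & forall v s, `|t - s| < d ->
      trace (g v) (h s) -> (i <= lay v)%N.
    suff [d d0 dP] : exists2 d, 0 < d & forall v, v \in enum V -> forall s,
        `|t - s| < d -> trace (g v) (h s) -> (i <= lay v)%N.
      by exists d => // v; apply: dP; rewrite mem_enum.
    elim: (enum V) => [|v r [d d0 dP]]; first by exists 1.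
    have [d' d'0 d'P] := each v.
    exists (Num.min d d'); first by rewrite lt_min d0.
    move=> x; rewrite inE => /predU1P[->|xr] s; rewrite lt_min => /andP[? ?].
      exact: d'P.
    exact: dP.
  exists (Num.min d (1 - t)); first by rewrite lt_min d0.
  move=> r r01; rewrite lt_min => /andP[td t1''] [[v vr vi]|r1].
    by have := dP v r td vr; rewrite leqNgt vi.
  by move: t1''; rewrite r1 distrC ltNge ler_norm.
have [s0 s1] := andP s01.
pose X1 := h @` `[0, s].
have X1K : X1 `<=` ~` U by move=> _ [r _ <-]; apply: (gK (v := y)); apply: hy.
have X1p : pathin X1 w (h s).
  rewrite -h0; apply: pathin_image => //; first exact: cont_within.
    by rewrite lexx s0.
  by rewrite s0 lexx.
(* Before time [s] no lower layer is met, so only up-neighbours of [y] are; a string met at the end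
   point alone is charged to the rest of the leg. *)
have X1m v : v \in met X1 -> v \in up_nbrs e lay y \/ trace (g v) (h s).
  move=> /metP[z vz [r + Er]]; rewrite /= in_itv /= => /andP[r0].
  rewrite le_eqVlt => /predU1P[rs|rs]; first by right; rewrite -rs Er.
  left; rewrite in_up_nbrs; have [//|vy] := eqVneq v y.
  have /not_orP[nlow _] : ~ (low r \/ r = 1) by apply: smin; rewrite r0.
  apply/andP; split.
    by apply/(ge (u := y)); [rewrite eq_sym|exists z; split=> //; rewrite -Er].
  by rewrite yi leqNgt; apply/negP => vi; apply: nlow; exists v; rewrite // Er.
have [[y0 y0s y0i]|nlow] := pselect (low s).
  have [y' y's y'min] : exists2 y', trace (g y') (h s) &
      forall v, trace (g v) (h s) -> (lay y' <= lay v)%N.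
    have y0P : `[< trace (g y0) (h s) >] by apply/asboolP.
    case: (@arg_minnP V y0 (fun v => `[< trace (g v) (h s) >]) lay y0P) => y' /asboolP y's mn.
    by exists y' => // v vs; apply: mn; apply/asboolP.
  have y'i : (lay y' < i)%N by apply: leq_ltn_trans y0i; apply: y'min.
  have [X [t [XK Xp t01 Xm]]] := IH (lay y') (h s) y' (leq_trans y'i le_in) y's erefl y'min.
  exists (X1 `|` X), t; split=> //.
  - by move=> z [/X1K|/XK].
  - apply: (@pathin_trans _ _ _ (h s)).
      by apply: pathin_sub X1p => z; left.
    by apply: pathin_sub Xp => z; right.
  rewrite mulSn; apply: (@card_le_union V (up_nbrs e lay y) (met X)) => //.
    move=> v /metP[z vz [X1z|Xz]]; last by right; apply/metP; exists z.
    have /X1m[] : v \in met X1 by apply/metP; exists z.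
      by left.
    by move=> vs; right; apply/metP; exists (h s) => //; case: (pathin_in Xp).
  by apply: leq_trans Xm _; rewrite leq_mul2r y'i orbT.
have sE : s = 1 by case: Ps.
have [t t01 Ct] := traceP HC (gC y).
exists X1, t; split=> //; first by rewrite Ct -h1 -sE.
apply: leq_trans (leq_trans (lay_b y) _); last by rewrite mulSn leq_addr.
apply: card_le_sub => v vX1; have [//|vs] := X1m v vX1.
rewrite in_up_nbrs; have [//|vy] := eqVneq v y; apply/andP; split.
  by apply/(ge (u := y)); [rewrite eq_sym|exists (h s)].
by rewrite yi leqNgt; apply/negP => vi; apply: nlow; exists v.
Qed.

(** The leg runs straight towards an exterior point up to the first string or [C]. Strings met by
    this part all pass through its end point, hence form a clique or are already counted by
    [string_leg], which continues from there. A point of [C] gets the constant leg. *)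
Lemma leg z : ~ U z -> exists X t, [/\ X `<=` ~` U, pathin X z (C t), 0 <= t < 1,
  (#|met X| <= l * b)%N & trace C z -> X = [set z] /\ C t = z].
Proof.
move=> nUz.
have through (X : set pt) w : (forall v x, trace (g v) x -> X x -> trace (g v) w) ->
    (#|met X| <= l * b)%N.
  move=> Xw; have [V0|/set0Pn[v0 _]] := eqVneq (met X) finset.set0.
    by rewrite V0 cards0.
  have l0 : (0 < l)%N by apply: leq_ltn_trans (lay_lt v0).
  apply: (@leq_trans b); last by rewrite leq_pmull.
  apply: leq_trans qb; apply: met_clique => u v /metP[x ux Xx] /metP[y vy Xy].
  by exists w; split; [apply: Xw Xx|apply: Xw Xy].
have [Cz|nCz] := pselect (trace C z).
  have [t t01 Ct] := traceP HC Cz.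
  exists [set z], t; split=> //.
  - by move=> _ ->.
  - by rewrite Ct; apply: pathin_refl.
  - by apply: (through _ z) => v x vx <-.
have [M [_ [M0 _ far _]]] := exterior_setup HC Ip.
have [x Ux] : exists x, U x.
  by exists (p.1 + M, p.2); apply: far; left; rewrite /= addrC addKr gtr0_norm.
have [s [s01 Cs soff sK]] := reach_trace nUz Ux.
have [s0 s1] := andP s01.
pose low r := exists v, trace (g v) (seg z x (s * r)).
have [||r [r01 Pr rmin]] := @first_hit R (fun r => low r \/ r = 1).
- by right.
- move=> t t01 /not_orP[nlow t1n].
  have t1' : 0 < 1 - t.
    by move: t01 => /andP[_ ?]; rewrite subr_gt0 lt_neqAle; apply/andP; split=> //; apply/eqP.
  have hc : continuous (fun r => seg z x (s * r)).
    apply: (cont_comp (@seg_cont _ z x) (h := fun r => s * r)) => r.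
    by apply: cvgM; [apply: cvg_cst|apply: cvg_id].
  have [d d0 dP] : exists2 d, 0 < d & forall v r, `|t - r| < d ->
      ~ trace (g v) (seg z x (s * r)).
    suff [d d0 dP] : exists2 d, 0 < d & forall v, v \in enum V -> forall r,
        `|t - r| < d -> ~ trace (g v) (seg z x (s * r)).
      by exists d => // v; apply: dP; rewrite mem_enum.
    elim: (enum V) => [|v rr [d d0 dP]]; first by exists 1.
    have nv : ~ trace (g v) (seg z x (s * t)) by move=> vt; apply: nlow; exists v.
    have [e1 e10 e1P] := compact_ball_free (@curve_compact _ _ (@gc v)) nv.
    have [d' d'0 d'P] := (cont_eps _).1 hc t e1 e10.
    exists (Num.min d d'); first by rewrite lt_min d0.
    move=> u; rewrite inE => /predU1P[->|xr] k; rewrite lt_min => /andP[? ?].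
      by apply/e1P/d'P/ballR.
    exact: dP.
  exists (Num.min d (1 - t)); first by rewrite lt_min d0.
  move=> k k01; rewrite lt_min => /andP[td t1''] [[v vr]|k1].
    exact: dP td vr.
  by move: t1''; rewrite k1 distrC ltNge ler_norm.
have [r0 r1] := andP r01.
set w := seg z x (s * r).
pose X1 := seg z x @` `[0, s * r].
have sr0 : 0 <= s * r by apply: mulr_ge0.
have srs : s * r <= s by rewrite ler_piMr.
have X1K : X1 `<=` ~` U.
  move=> _ [k + <-]; rewrite /= in_itv /= => /andP[k0 ksr]; apply: sK.
  by rewrite k0 (le_trans ksr).
have X1p : pathin X1 z w by apply: seg_pathin; rewrite ?lexx ?sr0.
have X1m v y : trace (g v) y -> X1 y -> trace (g v) w.
  move=> vy [k + Ek]; rewrite /= in_itv /= => /andP[k0].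
  rewrite le_eqVlt => /predU1P[ksr|ksr]; first by rewrite /w -ksr Ek.
  have sp : 0 < s by rewrite lt_neqAle s0 andbT; apply: contraTneq ksr => <-; rewrite mul0r -leNgt.
  case: (rmin (k / s)); first by rewrite divr_ge0 //= ltr_pdivrMr // mulrC.
  by left; exists v; rewrite mulrC divfK ?gt_eqF // Ek.
have [low_r|nlow] := pselect (low r).
  have [v0 v0w] := low_r.
  have [y yw ymin] : exists2 y, trace (g y) w &
      forall v, trace (g v) w -> (lay y <= lay v)%N.
    have v0P : `[< trace (g v0) w >] by apply/asboolP.
    case: (@arg_minnP V v0 (fun v => `[< trace (g v) w >]) lay v0P) => y /asboolP yw mn.
    by exists y => // v vw; apply: mn; apply/asboolP.
  have [X [t [XK Xp t01 Xm]]] := string_leg yw erefl ymin.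
  exists (X1 `|` X), t; split=> //.
  - by move=> y' [/X1K|/XK].
  - apply: (@pathin_trans _ _ _ w); first by apply: pathin_sub X1p => y'; left.
    by apply: pathin_sub Xp => y'; right.
  - apply: leq_trans (leq_trans Xm _); last by rewrite leq_mul2r lay_lt orbT.
    apply: card_le_sub => v /metP[y' vy' [X1y|Xy]]; apply/metP.
      by exists w; [apply: X1m X1y|case: (pathin_in Xp)].
    by exists y'.
have rE : r = 1 by case: Pr.
have Cw : trace C w by rewrite /w rE mulr1.
have [t t01 Ct] := traceP HC Cw.
exists X1, t; split=> //; first by rewrite Ct.
exact: through X1m.
Qed.
End Strings.

(** * Balanced separators from the angle of legs *)

Section Balanced.
Variable R : realType.
Local Notation pt := (R * R)%type.
Variable C : R -> pt.
Hypothesis HC : simple_closed_curve C.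
Variable p : pt.
Hypothesis Ip : curve_interior C p.
Local Notation U := (exterior C).
Variables (V : finType) (e : rel V) (g : V -> R -> pt).
Hypothesis e_sym : symmetric e.
Hypothesis gc : forall v, curve (g v).
Hypothesis gC : forall v, trace C (g v 0).
Hypothesis gK : forall v, trace (g v) `<=` ~` U.
Hypothesis ge : forall u v, u != v -> e u v <-> trace (g u) `&` trace (g v) !=set0.
Local Notation met := (met g).

Lemma root_trace v : trace (g v) (g v 0).
Proof. by exists 0; rewrite //= in_itv /= lexx ler01. Qed.

Lemma reach_pathin (S : {set V}) v u : v \notin S -> u \in reach e (~: S) v ->
  pathin [set z | exists2 w, w \notin S & trace (g w) z] (g v 0) (g u 0).
Proof.
move=> vS uv; set Y := [set z | _].
have sub w x y : w \notin S -> trace (g w) x -> trace (g w) y -> pathin Y x y.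
  move=> wS [s + <-] [t + <-]; rewrite /= !in_itv /= => s01 t01.
  apply: pathin_sub (pathin_image ler01 (@gc w) s01 t01) => z wz.
  by exists w.
have [] // := @reach_ind_path V e S (fun x => pathin Y (g v 0) (g x 0)) v u vS uv.
  by apply: (sub v) => //; exact: root_trace.
move=> x y xS yS exy vx; have [xy|xy] := eqVneq x y; first by rewrite -xy.
have [z [xz yz]] := (ge xy).1 exy.
apply: (pathin_trans vx); apply: (@pathin_trans _ _ _ z).
  by apply: (sub x) => //; exact: root_trace.
by apply: (sub y) => //; exact: root_trace.
Qed.

Variable psi : R -> R.
Hypothesis psic : continuous psi.
Hypothesis psiP : forall t, 0 <= t <= 1 -> is_arg (C t - p) (psi t).
Local Notation turn := (cut_angle psi).

(** If just one of [r] and [r'] lay between [s] and [t], the ends of the two paths would alternate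
    on [C] and [crossing] would make them meet. Otherwise both parameters cut the same arc of [C],
    and the turn depends only on which arc is cut. *)
Lemma same_side (X Y : set pt) (s t r r' : R) : X `<=` ~` U -> Y `<=` ~` U ->
  (forall z, X z -> ~ Y z) ->
  0 <= s < 1 -> 0 <= t < 1 -> 0 <= r < 1 -> 0 <= r' < 1 ->
  pathin X (C s) (C t) -> pathin Y (C r) (C r') ->
  turn r t - turn r s = turn r' t - turn r' s.
Proof.
move=> XK YK XY s01 t01 r01 r01' Xst Yrr'.
have [[Xs Xt] [Yr Yr']] := (pathin_in Xst, pathin_in Yrr').
have ne a b : X (C a) -> Y (C b) -> a <> b by move=> Xa Yb ab; apply: (XY _ Xa); rewrite ab.
have nocross (a b k k' : R) : 0 <= a -> b < 1 -> 0 <= k' < 1 ->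
    pathin X (C a) (C b) -> pathin Y (C k) (C k') -> a < k -> k < b ->
    k' < a \/ b < k' -> False.
  move=> a0 b1 /andP[k0 k1] Xab Ykk ak kb [k'a|bk'].
    have [z [Yz Xz]] := crossing HC Ip YK XK k0 k'a ak kb b1 (pathin_sym Ykk) Xab.
    exact: XY Yz.
  by have [z [Xz Yz]] := crossing HC Ip XK YK a0 ak kb bk' k1 Xab Ykk; exact: XY Yz.
have [s0 s1] := andP s01; have [t0 t1] := andP t01.
have side (a b k k' : R) : 0 <= a -> b < 1 -> 0 <= k < 1 -> 0 <= k' < 1 -> X (C a) -> X (C b) ->
    Y (C k) -> Y (C k') ->
    pathin X (C a) (C b) -> pathin Y (C k) (C k') -> a < k -> k < b -> a < k' /\ k' < b.
  move=> a0 b1 k01 k01' Xa Xb Yk Yk' Xab Ykk ak kb.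
  have := ne _ _ Xa Yk'; have := ne _ _ Xb Yk' => /eqP bk' /eqP ak'.
  have := nocross _ _ _ _ a0 b1 k01' Xab Ykk ak kb.
  case: (ltgtP k' a) ak' => [k'a _ H|ak'' _ H|->]; last by rewrite ?eqxx.
    by case: H; left.
  case: (ltgtP k' b) bk' => [//|bk'' _|//].
  by case: H; right.
have Yr'r := pathin_sym Yrr'; have Xts := pathin_sym Xst.
have h1 := side _ _ _ _ s0 t1 r01 r01' Xs Xt Yr Yr' Xst Yrr'.
have h2 := side _ _ _ _ s0 t1 r01' r01 Xs Xt Yr' Yr Xst Yr'r.
have h3 := side _ _ _ _ t0 s1 r01 r01' Xt Xs Yr Yr' Xts Yrr'.
have h4 := side _ _ _ _ t0 s1 r01' r01 Xt Xs Yr' Yr Xts Yr'r.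
have /eqP := ne _ _ Xs Yr; have /eqP := ne _ _ Xt Yr.
have /eqP := ne _ _ Xs Yr'; have /eqP := ne _ _ Xt Yr'.
rewrite /cut_angle.
case: (ltgtP r t) h1 h2 h3 h4 => // rt; case: (ltgtP r s) => // rs;
  case: (ltgtP r' t) => // r't; case: (ltgtP r' s) => // r's h1 h2 h3 h4 _ _ _ _; try lra;
  by [case: (h1 isT isT) | case: (h2 isT isT) | case: (h3 isT isT) | case: (h4 isT isT)].
Qed.

Variables (q l b : nat) (lay : V -> nat).
Hypothesis clique_q : forall S : {set V},
  (forall x y, x \in S -> y \in S -> x != y -> e x y) -> (#|S| <= q)%N.
Hypothesis qb : (q <= b)%N.
Hypothesis lay_lt : forall x, (lay x < l)%N.
Hypothesis lay_b : forall x, (#|up_nbrs e lay x| <= b)%N.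

(* Were there no balanced separators, the heavy component [beta] that survives
   the removal of the few strings met by two nearby legs would tell on which
   side of them to turn around [p]; this defines an additive angle on the
   whole closed region bounded by [C]. *)
Lemma outerstring_balanced : balanced e (9 * (l * b)).
Proof.
apply: contrapT => /(not_balanced_haven e_sym)[beta betaP].
have [v0 _] : exists v : V, True by exists (beta finset.set0).
have l0 : (0 < l)%N by apply: leq_ltn_trans (lay_lt v0).
have qlb : (q <= l * b)%N by apply: (leq_trans qb); rewrite leq_pmull.
have [ds ds0 dsP] := strings_apart gc.
have ds20 : 0 < ds / 2 by rewrite divr_gt0.
have small (z : pt) (X : set pt) : (forall w, X w -> ball z (ds / 2) w) ->
    (#|met X| <= l * b)%N.
  move=> Xz; apply: leq_trans qlb; apply: (met_clique ge clique_q) => u v.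
  move=> /metP[x ux /Xz zx] /metP[y vy /Xz zy]; apply: (dsP u v x y) => //.
  by rewrite (splitr ds); apply: ball_triangle (ball_sym zx) zy.
have [d1 d10 d1P] := local_path HC Ip psic psiP ds20.
have [d2 d20 d2P] := near_arc HC Ip psic psiP ds20.
have [X XP] : exists X : pt -> set pt * R, forall z, ~ U z -> [/\ (X z).1 `<=` ~` U,
    pathin (X z).1 z (C (X z).2), 0 <= (X z).2 < 1, (#|met (X z).1| <= l * b)%N &
    trace C z -> (X z).1 = [set z] /\ C (X z).2 = z].
  have H (z : pt) : exists Xt : set pt * R, ~ U z -> [/\ Xt.1 `<=` ~` U,
      pathin Xt.1 z (C Xt.2), 0 <= Xt.2 < 1, (#|met Xt.1| <= l * b)%N &
      trace C z -> Xt.1 = [set z] /\ C Xt.2 = z].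
    have [Uz|nUz] := pselect (U z); first by exists (set0, 0).
    have [Y [t Yt]] := leg HC Ip gc gC gK ge clique_q qb lay_lt lay_b nUz.
    by exists (Y, t).
  by have [f fP] := choice H; exists f.
have [P PP] : exists P : pt * pt -> set pt, forall zz, ~ U zz.1 -> ~ U zz.2 ->
    ball zz.1 d1 zz.2 -> [/\ P zz `<=` ~` U, pathin (P zz) zz.1 zz.2 &
      (#|met (P zz)| <= l * b)%N].
  have H (zz : pt * pt) : exists Q : set pt, ~ U zz.1 -> ~ U zz.2 ->
      ball zz.1 d1 zz.2 -> [/\ Q `<=` ~` U, pathin Q zz.1 zz.2 &
      (#|met Q| <= l * b)%N].
    have [[nU1 [nU2 zz12]]|n] := pselect (~ U zz.1 /\ ~ U zz.2 /\ ball zz.1 d1 zz.2).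
      have [Q [QK Qp Qb]] := d1P _ _ nU1 nU2 zz12.
      by exists Q => _ _ _; split=> //; apply: small Qb.
    by exists set0 => *; case: n.
  by have [f fP] := choice H; exists f.
have [rt rtP] : exists rt : V -> R, forall v, 0 <= rt v < 1 /\ C (rt v) = g v 0.
  have H (v : V) : exists r : R, 0 <= r < 1 /\ C r = g v 0.
    by have [r r01 Cr] := traceP HC (gC v); exists r.
  by have [f fP] := choice H; exists f.
pose XX x y : set pt := (X x).1 `|` P (x, y) `|` (X y).1.
pose B x y := let r := rt (beta (met (XX x y))) in
  turn r (X y).2 - turn r (X x).2.
have XXK x y : ~ U x -> ~ U y -> ball x d1 y -> XX x y `<=` ~` U.
  move=> nx ny xy z; have [K1 _ _ _ _] := XP _ nx; have [K2 _ _ _ _] := XP _ ny.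
  by have [K3 _ _] := PP (x, y) nx ny xy; case=> [[/K1|/K3]|/K2].
have XXp x y : ~ U x -> ~ U y -> ball x d1 y -> pathin (XX x y) (C (X x).2) (C (X y).2).
  move=> nx ny xy; have [_ p1 _ _ _] := XP _ nx; have [_ p2 _ _ _] := XP _ ny.
  have [_ p3 _] := PP (x, y) nx ny xy.
  apply: (@pathin_trans _ _ _ x).
    by apply: pathin_sub (pathin_sym p1) => z; left; left.
  apply: (@pathin_trans _ _ _ y); first by apply: pathin_sub p3 => z; left; right.
  by apply: pathin_sub p2 => z; right.
have XXm x y : ~ U x -> ~ U y -> ball x d1 y -> (#|met (XX x y)| <= 3 * (l * b))%N.
  move=> nx ny xy; have [_ _ _ m1 _] := XP _ nx; have [_ _ _ m2 _] := XP _ ny.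
  have [_ _ m3] := PP (x, y) nx ny xy.
  rewrite (_ : 3 * _ = l * b + l * b + l * b)%N; last by rewrite !mulSn mul0n addn0 addnA.
  by apply: met_union m2; apply: met_union.
(* The heavy components of both sets are joined by strings avoiding [XX x y], so [same_side] allows
   computing [B] from the larger set. *)
have BE (S : {set V}) x y : ~ U x -> ~ U y -> ball x d1 y ->
    (forall v, v \in met (XX x y) -> v \in S) -> (#|S| <= 9 * (l * b))%N ->
    B x y = turn (rt (beta S)) (X y).2 - turn (rt (beta S)) (X x).2.
  move=> nx ny xy subS Sm.
  have Mm : (#|met (XX x y)| <= 9 * (l * b))%N.
    by apply: leq_trans (XXm _ _ nx ny xy) _; rewrite leq_mul2r orbT.
  have [bn bS] := betaP _ Mm; have := bS S subS Sm => bSr.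
  have := reach_pathin bn bSr; set Y := [set z | _] => Yp.
  have [r01 Er] := rtP (beta (met (XX x y))); have [r01' Er'] := rtP (beta S).
  rewrite -Er -Er' in Yp.
  have [_ _ tx _ _] := XP _ nx; have [_ _ ty _ _] := XP _ ny.
  apply: (@same_side (XX x y) Y) => //.
  - exact: XXK.
  - by move=> z [w _ wz]; apply: gK wz.
  - by move=> z Xz [w /negP wn wz]; apply: wn; apply/metP; exists z.
  - exact: XXp.
have [M [eps [M0 eps0 far away]]] := exterior_setup HC Ip.
pose d := Num.min (d1 / 2) (d2 / 2).
have d0 : 0 < d by rewrite lt_min !divr_gt0.
have dd1 (k x y : pt) : ball k d x -> ball k d y -> ball x d1 y.
  have h (z : pt) : ball k d z -> ball k (d1 / 2) z by apply: le_ball; rewrite ge_min lexx.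
  by move=> /h kx /h ky; rewrite (splitr d1); apply: ball_triangle (ball_sym kx) ky.
have dd2 (k x y : pt) : ball k d x -> ball k d y -> ball x d2 y.
  have h (z : pt) : ball k d z -> ball k (d2 / 2) z.
    by apply: le_ball; rewrite ge_min lexx orbT.
  by move=> /h kx /h ky; rewrite (splitr d2); apply: ball_triangle (ball_sym kx) ky.
apply: (@no_angular_cocycle _ p U (trace C) B eps d M) => //.
- by move=> z; apply: trace_sub.
- move=> x y Ux nUy; have [t [t01 Ct _]] := cross_trace HC Ux nUy.
  by exists (seg x y t) => // k r kx ky; apply: seg_ball.
- move=> k x y z nx ny nz kx ky kz.
  have xy := dd1 _ _ _ kx ky; have yz := dd1 _ _ _ ky kz; have xz := dd1 _ _ _ kx kz.
  pose S := met (XX x y `|` XX y z `|` XX x z).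
  have Sm : (#|S| <= 9 * (l * b))%N.
    rewrite (_ : 9 * _ = 3 * (l * b) + 3 * (l * b) + 3 * (l * b))%N; last by rewrite -!mulnDl.
    by apply: met_union (XXm _ _ nx nz xz); apply: met_union; apply: XXm.
  rewrite (BE S x y) // ?(BE S y z) // ?(BE S x z) //.
  - by ring.
  - by move=> v; apply: met_sub => w; right.
  - by move=> v; apply: met_sub => w; left; right.
  - by move=> v; apply: met_sub => w; left; left.
move=> k x y Cx Cy kx ky.
have nx := trace_sub Cx; have ny := trace_sub Cy.
have xy := dd1 _ _ _ kx ky; have xy2 := dd2 _ _ _ kx ky.
have [_ _ tx _ /(_ Cx)[_ Ex]] := XP _ nx; have [_ _ ty _ /(_ Cy)[_ Ey]] := XP _ ny.
(* The strings meeting the short arc [Q] are removed too, so that the root of the heavy component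
   lies off [Q] and [near_arc] evaluates the turn. *)
have [Q [QC Qb _ QP]] : exists Q : set pt, [/\ Q `<=` trace C,
    forall z, Q z -> ball x (ds / 2) z, True &
    forall r, 0 <= r < 1 -> ~ Q (C r) ->
      turn r (X y).2 - turn r (X x).2 = ang (x - p) (y - p)].
  have xy3 : ball (C (X x).2) d2 (C (X y).2) by rewrite Ex Ey.
  have [Q [Q1 Q2 _ Q3]] := d2P _ _ tx ty xy3; rewrite Ex Ey in Q2 Q3.
  by exists Q; split.
pose S := met (XX x y `|` Q).
have Sm : (#|S| <= 9 * (l * b))%N.
  apply: (@leq_trans (3 * (l * b) + l * b)).
    by apply: met_union (small x Q Qb); apply: XXm.
  by rewrite -mulSnr leq_mul2r orbT.
rewrite (BE S x y) //; last by move=> v; apply: met_sub => w; left.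
have [r01 Er] := rtP (beta S); apply: QP => // Qr.
have [/negP bS _] := betaP _ Sm; apply: bS; apply/metP; exists (g (beta S) 0).
  exact: root_trace.
by right; rewrite -Er.
Qed.

End Balanced.

(* The logarithmic bound on treewidth *)
Local Close Scope classical_set_scope.

Theorem theorem1 (R : realType) :
  exists c : R, 0 < c /\
    forall (V : finType) (e : rel V) (a : nat),
      simple_graph e -> outerstring R e -> (2 <= #|V|)%N ->
      is_arboricity e a ->
      treewidth_le e (c * a%:R * ln (#|V|%:R)).
Proof.
have ln2 : 0 < ln (2 : R) by apply: ln_gt0; rewrite ltr1n.
(* With [b = 4 a] and [L + 1 <= 2 L] layers the bags have at most
   [3 * 9 * 2 L * 4 a + 2 = 216 a L + 2] vertices; the remaining [2 a L] absorbs the additive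
   constant, and [L <= ln n / ln 2]. *)
exists (218 / ln 2); split; first by rewrite divr_gt0 ?ltr0n.
move=> V e a [e_sym eirr] [C [g [HC [gc [gC [gcl ge]]]]]] V2 [ea _].
have V0 : (0 < #|V|)%N by exact: ltnW.
have [v0 _] : exists v0, v0 \in V by apply/card_gt0P.
case: (posnP a) => [a0|a0].
  have e0 u v : ~~ e u v.
    case: ea => col [_ [col_lt _]]; apply/negP => /col_lt; by rewrite a0.
  have [t [B [tB B1]]] := edgeless_treewidth V0 e0.
  exists V, t, B; split=> // x; rewrite a0 mulr0 mul0r subr_le0.
  by rewrite -[1]/(1%:R) ler_nat.
(* A string lies in the closure of the interior, so the interior is not empty. *)
have [p Ip] : exists p, curve_interior C p.
  have /gcl/(_ setT filterT)[p [Ip _]] : trace (g v0) (g v0 0).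
    exact: root_trace.
  by exists p.
have [psi psic psiP] := winding_lift HC Ip.
have gK v : (trace (g v) `<=` ~` exterior C)%classic.
  exact: subset_trans (gcl v) (closure_interior_sub HC).
have Vlog : (#|V| < 2 ^ (trunc_log 2 #|V|).+1)%N by apply: trunc_log_ltn.
set L := trunc_log 2 #|V| in Vlog.
have L0 : (0 < L)%N by rewrite trunc_log_gt0.
have [lay [lay_lt lay_b]] := layering e_sym eirr ea a0 Vlog.
have qb : ((2 * a).+1 <= 4 * a)%N by lia.
have cl (S : {set V}) : (forall x y, x \in S -> y \in S -> x != y -> e x y) ->
    (#|S| <= (2 * a).+1)%N.
  by move=> h; apply: (clique_bound e_sym eirr ea) => x y xS yS; apply: h.
have bal := outerstring_balanced HC Ip e_sym gc gC gK ge psic psiP cl qb lay_lt lay_b.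
have [t [B [tB Bk]]] := treewidth_of_balanced e_sym V0 eirr bal.
exists V, t, B; split=> // x.
have Lln : L%:R * ln 2 <= ln #|V|%:R :> R.
  rewrite mulr_natl -lnXn // ler_ln ?posrE ?exprn_gt0 ?ltr0n //.
  by rewrite -natrX ler_nat; apply: trunc_logP.
apply: (@le_trans _ _ (218 * a%:R * L%:R)); last first.
  rewrite -!mulrA ler_pM2l ?ltr0n // mulrCA ler_pM2l ?ltr0n //.
  by rewrite mulrC ler_pdivlMr.
rewrite lerBlDr -!natrM natr1 ler_nat.
by apply: leq_trans (Bk x) _; nia.
Qed.
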